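(* Let $\mu$ be any Borel probability measure on $\mathbb{C}$ supported in the unit circle $\partial\mathbb{D}=\{z\in\mathbb{C}:|z|=1\}$, and let $Z_1,Z_2,\dots$ be i.i.d. complex-valued random variables with law $\mu$ on a probability space $(\Omega,\mathbb{P})$. For $\omega\in\Omega$ and $n\ge 1$ put $P_n(\omega)(z)=(z-Z_1(\omega))\cdots(z-Z_n(\omega))$. Fix any $k\in\mathbb{N}=\{1,2,\dots\}$. For $n\ge k+1$ let $W^{(k)}_{n,1}(\omega),\dots,W^{(k)}_{n,n-k}(\omega)$ be the zeros, counted with multiplicity, of the $k$-th order derivative of the polynomial $P_n(\omega)$, and let $$\mu^{(k)}_n(\omega)=\frac{1}{n-k}\sum_{j=1}^{n-k}\delta_{W^{(k)}_{n,j}(\omega)}.$$ Then, almost surely, $\mu^{(k)}_n$ converges weakly to $\mu$ as $n\to\infty$; that is, $\mathbb{P}\{\omega\in\Omega:\mu^{(k)}_n(\omega)\rightharpoonup\mu\text{ as }n\to\infty\}=1$.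
   Context: A probability measure $\mu$ on $\mathbb{C}$ (with the Borel $\sigma$-algebra) is supported in a closed set $S$ if $\mu(S)=1$. $\delta_x$ denotes the Dirac measure at $x$. $\rightharpoonup$ denotes weak convergence of probability measures on $\mathbb{C}$. *)

(* Defs.v *)
From HB Require Import structures.
From mathcomp Require Import all_boot all_order all_algebra.
From mathcomp Require Import complex.
From mathcomp Require Import all_classical all_reals all_analysis.

Set Implicit Arguments.
Unset Strict Implicit.
Unset Printing Implicit Defensive.

Import Order.TTheory GRing.Theory Num.Theory numFieldNormedType.Exports.

Local Open Scope classical_set_scope.
Local Open Scope ring_scope.
Local Open Scope complex_scope.

(* R[i]^o is R[i] with the topology of its modulus, so the sigma-algebra here
   is the Borel one. *)
Notation borelC R := (g_sigma_algebraType (open : set (set (R[i])^o))).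

Definition mutually_independent d d' (T : measurableType d)
    (T' : measurableType d') (R : realType) (P : probability T R)
    (X : nat -> {RV P >-> T'}) : Prop :=
  forall (J : seq nat) (A : nat -> set T'), uniq J ->
    (forall i, measurable (A i)) ->
    P (\bigcap_(i in [set` J]) (X i @^-1` A i)) =
    (\prod_(i <- J) P (X i @^-1` A i))%E.

Arguments mutually_independent {d d' T T' R} P X.

Definition iid_with_law d d' (T : measurableType d) (T' : measurableType d')
    (R : realType) (P : probability T R) (X : nat -> {RV P >-> T'})
    (mu : probability T' R) : Prop :=
  mutually_independent P X /\
  forall (n : nat) (A : set T'), measurable A -> distribution P (X n) A = mu A.

Arguments iid_with_law {d d' T T' R} P X mu.

Definition weakly_converges (R : realType)
    (mu_ : nat -> {measure set (borelC R) -> \bar R})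
    (mu : {measure set (borelC R) -> \bar R}) : Prop :=
  forall f : (R[i])^o -> R, continuous f ->
    (exists M : R, forall z, `|f z| <= M) ->
    (\int[mu_ n]_z (f z)%:E)%E @[n --> \oo] --> (\int[mu]_z (f z)%:E)%E.

Section zeros.
Context {R : realType}.
Implicit Type p : {poly R[i]}.

(* The zeros are listed with multiplicity, in an unspecified order. *)
Definition zeros p : seq R[i] := sval (closed_field_poly_normal p).

Lemma zerosE p : p = lead_coef p *: \prod_(z <- zeros p) ('X - z%:P).
Proof. by rewrite /zeros; case: closed_field_poly_normal. Qed.

Lemma size_zeros p : p != 0 -> size (zeros p) = (size p).-1.
Proof.
move=> p0; rewrite [in RHS](zerosE p) size_scale ?lead_coef_eq0//.
by rewrite size_prod_XsubC.
Qed.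

(* (z - a_0) ... (z - a_(n-1)); the samples Z_1, Z_2, ... are indexed from 0. *)
Definition sample_poly (a : nat -> R[i]) (n : nat) : {poly R[i]} :=
  \prod_(i < n) ('X - (a i)%:P).

Lemma size_zeros_derivn (a : nat -> R[i]) (n k : nat) : (k <= n)%N ->
  size (zeros (sample_poly a n)^`(k)) = (n - k)%N.
Proof.
move=> kn; set p := sample_poly a n.
have sp : size p = n.+1.
  by rewrite /p /sample_poly size_prod_XsubC /index_enum -enumT size_enum_ord.
have mp : lead_coef p = 1 by apply/monicP; exact: monic_prod_XsubC.
have c0 : p^`(k)`_(n - k) != 0.
  rewrite coef_derivn subnKC// (_ : p`_n = 1); last by rewrite -mp lead_coefE sp.
  by rewrite pnatr_eq0 -lt0n ffact_gt0.
have sd : size p^`(k) = (n - k).+1.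
  apply/eqP; rewrite eqn_leq; apply/andP; split; last first.
    by rewrite ltnNge; apply: contraNN c0 => ?; apply/eqP/nth_default.
  apply/leq_sizeP => j jn; rewrite coef_derivn nth_default ?mul0rn//.
  by rewrite sp -leq_subLR subSn.
by rewrite size_zeros ?sd// -size_poly_gt0 sd.
Qed.

(* For n <= k this is the zero measure; size_zeros_derivn ensures that the
   default value of the sequence access is never used. *)
Definition derivn_zeros_measure (a : nat -> R[i]) (k n : nat) :
    {measure set (borelC R) -> \bar R} :=
  mscale (((n - k)%:R : R)^-1)%:nng
    (msum (fun j => \d_((zeros (sample_poly a n)^`(k))`_j : borelC R)) (n - k)).

End zeros.

(* Main.v *)
Require Import Defs.
From HB Require Import structures.
From mathcomp Require Import all_boot all_order all_algebra.
From mathcomp Require Import complex.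
From mathcomp Require Import all_classical all_reals all_analysis.
From mathcomp Require Import measurable_realfun.
From mathcomp Require Import ring lra.

Set Implicit Arguments.
Unset Strict Implicit.
Unset Printing Implicit Defensive.

Import Order.TTheory GRing.Theory Num.Theory numFieldNormedType.Exports.

Local Open Scope classical_set_scope.
Local Open Scope ring_scope.
Local Open Scope complex_scope.

(* Write P for P_n, Z_i for its zeros, Q for its k-th derivative and W_j for the
   zeros of Q, which lie in the closed disk by Gauss-Lucas.

   1. Outside the closed disk the logarithmic derivatives of a polynomial of
   degree n with zeros in the disk and of its derivative differ by O(1), because
   their difference is L'/L with |L'| = O(n) and |L| >= c n. Hence the averages
   of every Poisson kernel with pole outside the disk over the W_j and over the
   Z_i have the same limit.

   2. Suppose |Q(w)| >= n^(-B) |P(w)| for some fixed w <> 0 in the open disk and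
   all large n. Comparing Q at w and at 1 / conj w shows that the Blaschke
   product of the W_j at w is at least n^(-B'), so the sum of 1 - |W_j|^2 is
   O(log n): the W_j accumulate on the circle.

   3. A continuous f differs from a finite combination of Poisson kernels by at
   most e + C (1 - |z|^2) on the closed disk. By 1 and 2 the averages of f over
   the W_j and over the Z_i have the same limit, which is the integral of f by
   the strong law of large numbers.

   4. The lower bound in 2 holds almost surely for a suitable w. If m is the
   least positive integer with a nonzero m-th moment of mu, then by the strong
   law sum_i 1 / (w - Z_i) is of exact order n for small w, and Q(w) / P(w) is
   asymptotic to its k-th power. If all moments of positive order vanish, then
   arcs of length 1/N have measure O(1/N) (integrate |1 + z + ... + z^(N-1)|^2);
   as Q(w) / P(w) is affine in each 1 / (w - Z_i), it is smaller than c n^(-2k)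
   with probability O(n^(-2)), and Borel-Cantelli applies. *)

Local Notation Re := complex.Re.
Local Notation Im := complex.Im.

(** * The modulus and the Poisson kernel *)

Section modulus.
Context {R : realType}.
Implicit Types z w : R[i].

Definition modc z : R := Normc.normc z.

Lemma modcE z : `|z| = (modc z)%:C.
Proof. by rewrite normc_def; case: z. Qed.

Lemma modc_ge0 z : 0 <= modc z.
Proof. by case: z => a b; exact: sqrtr_ge0. Qed.

Lemma modc_sq z : modc z ^+ 2 = Re z ^+ 2 + Im z ^+ 2.
Proof. by case: z => a b /=; rewrite sqr_sqrtr// addr_ge0// sqr_ge0. Qed.

Lemma modcM z w : modc (z * w) = modc z * modc w.
Proof. exact: Normc.normcM. Qed.

Lemma modcV z : modc z^-1 = (modc z)^-1.
Proof. exact: Normc.normcV. Qed.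

Lemma modc0 : modc 0 = 0. Proof. exact: Normc.normc0. Qed.

Lemma modc1 : modc 1 = 1. Proof. exact: Normc.normc1. Qed.

Lemma modcN z : modc (- z) = modc z. Proof. exact: normcN. Qed.

Lemma modc_real (x : R) : modc x%:C = `|x|.
Proof. by rewrite /modc /= expr0n/= addr0 sqrtr_sqr. Qed.

Lemma modc_eq0 z : (modc z == 0) = (z == 0).
Proof. by apply/eqP/eqP => [/Normc.eq0_normc//|->]; exact: modc0. Qed.

Lemma modc_gt0 z : (0 < modc z) = (z != 0).
Proof. by rewrite lt_def modc_eq0 modc_ge0 andbT. Qed.

Lemma modc_conj z : modc (conjc z) = modc z.
Proof. by case: z => a b; rewrite /modc /= sqrrN. Qed.

Lemma ler_modcD z w : modc (z + w) <= modc z + modc w.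
Proof. exact: le_normcD. Qed.

Lemma modcBC z w : modc (z - w) = modc (w - z).
Proof. by rewrite -modcN opprB. Qed.

Lemma ler_modcB z w : modc z - modc w <= modc (z - w).
Proof. by rewrite lerBlDr; apply: le_trans (ler_modcD _ _); rewrite subrK. Qed.

Lemma modcX z n : modc (z ^+ n) = modc z ^+ n.
Proof. by elim: n => [|n IH]; rewrite ?expr0 ?modc1// !exprS modcM IH. Qed.

Lemma modc_nat n : modc n%:R = n%:R.
Proof. by rewrite -(rmorph_nat (real_complex R)) modc_real ger0_norm. Qed.

Lemma modc_prod I (s : seq I) (F : I -> R[i]) :
  modc (\prod_(i <- s) F i) = \prod_(i <- s) modc (F i).
Proof. exact: (big_morph modc modcM modc1). Qed.

Lemma ler_modc_sum I (s : seq I) (P : pred I) (F : I -> R[i]) :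
  modc (\sum_(i <- s | P i) F i) <= \sum_(i <- s | P i) modc (F i).
Proof.
elim/big_rec2 : _ => [|i y x _ h]; first by rewrite modc0.
by apply: (le_trans (ler_modcD _ _)); rewrite lerD2l.
Qed.

Lemma normr_Re_le z : `|Re z| <= modc z.
Proof. by rewrite -lecR -modcE; exact: normc_ge_Re. Qed.

Lemma normr_Im_le z : `|Im z| <= modc z.
Proof.
rewrite -(ler_pXn2r (n := 2)) ?nnegrE ?normr_ge0 ?modc_ge0//.
by rewrite modc_sq real_normK ?num_real// lerDr sqr_ge0.
Qed.

Lemma modc_le z : modc z <= `|Re z| + `|Im z|.
Proof.
rewrite -(ler_pXn2r (n := 2)) ?nnegrE ?addr_ge0 ?modc_ge0//.
rewrite modc_sq sqrrD !real_normK ?num_real// lerD2r lerDl.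
by rewrite mulrn_wge0// mulr_ge0.
Qed.

Lemma conjc_unit z : modc z = 1 -> conjc z = z^-1.
Proof. by move=> z1; rewrite invc_norm modcE z1 expr1n invr1 mul1r. Qed.

Lemma conjcB z w : conjc (z - w) = conjc z - conjc w.
Proof. exact: (rmorphB (@conjc R)). Qed.

Lemma ReD z w : Re (z + w) = Re z + Re w.
Proof. by case: z => ? ?; case: w. Qed.

Lemma ReB z w : Re (z - w) = Re z - Re w.
Proof. by case: z => ? ?; case: w. Qed.

Lemma Re_sum I (s : seq I) (F : I -> R[i]) :
  Re (\sum_(i <- s) F i) = \sum_(i <- s) Re (F i).
Proof. exact: (big_morph (@Re R) ReD erefl). Qed.

Lemma ImD z w : Im (z + w) = Im z + Im w.
Proof. by case: z => ? ?; case: w. Qed.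

Lemma Im_sum I (s : seq I) (F : I -> R[i]) :
  Im (\sum_(i <- s) F i) = \sum_(i <- s) Im (F i).
Proof. exact: (big_morph (@Im R) ImD erefl). Qed.

End modulus.

Section poisson.
Context {R : realType}.
Implicit Types z w : R[i].

Definition poisson w z : R := Re ((w + z) / (w - z)).

Lemma poissonE w z : w != z ->
  poisson w z = (modc w ^+ 2 - modc z ^+ 2) / modc (w - z) ^+ 2.
Proof.
rewrite -subr_eq0 -modc_eq0 -sqrf_eq0 !modc_sq /poisson.
case: w => a b; case: z => c d /=.
by simpc => /= h; field.
Qed.

(** This form turns averages of Poisson kernels over the zeros of a polynomial into values of its
    logarithmic derivative. *)
Lemma poissonE2 w z : w != z -> poisson w z = Re (2%:R * w / (w - z)) - 1.
Proof.
move=> wz; rewrite /poisson.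
have -> : (w + z) / (w - z) = 2%:R * w / (w - z) - 1.
  by field; rewrite subr_eq0.
by rewrite ReD.
Qed.

Lemma modc_ltP w z : modc z < modc w -> w != z.
Proof. by apply: contraTneq => ->; rewrite ltxx. Qed.

Lemma poisson_ge0 w z : modc z < modc w -> 0 <= poisson w z.
Proof.
move=> zw; rewrite poissonE ?modc_ltP//.
by rewrite divr_ge0 ?sqr_ge0// subr_ge0 ler_sqr ?nnegrE ?modc_ge0// ltW.
Qed.

End poisson.

(** * Logarithmic derivatives and zeros of derivatives *)

Section log_derivative.
Context {R : realType}.
Implicit Types (s : seq R[i]) (w z : R[i]).

Local Notation prodX s := (\prod_(z <- s) ('X - z%:P)).

Lemma horner_prodX s w : (prodX s).[w] = \prod_(z <- s) (w - z).
Proof.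
by rewrite horner_prod; apply: eq_bigr => z _; rewrite hornerXsubC.
Qed.

Lemma deriv_prodX s w : w \notin s ->
  (prodX s)^`().[w] = (prodX s).[w] * \sum_(z <- s) (w - z)^-1.
Proof.
elim: s => [|x s IH]; first by rewrite !big_nil -polyC1 derivC horner0 mulr0.
rewrite inE negb_or -subr_eq0 => /andP[wx ws].
rewrite !big_cons derivM derivXsubC mul1r hornerD !hornerM hornerXsubC IH//.
by field.
Qed.

(** With [L] the logarithmic derivative, this is p'' = p (L^2 + L'), the sum of the squared inverses
    being -L'. *)
Lemma deriv2_prodX s w : w \notin s ->
  (prodX s)^`()^`().[w] = (prodX s).[w] *
    ((\sum_(z <- s) (w - z)^-1) ^+ 2 - \sum_(z <- s) (w - z)^-1 ^+ 2).
Proof.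
elim: s => [|x s IH].
  by rewrite !big_nil -polyC1 !derivC horner0 expr0n subr0 mulr0.
rewrite inE negb_or -subr_eq0 => /andP[wx ws].
rewrite !big_cons derivM derivXsubC mul1r derivD derivM derivXsubC mul1r.
rewrite !hornerD !hornerM hornerXsubC IH// deriv_prodX//.
by field.
Qed.

Definition in_disk s := forall z, z \in s -> modc z <= 1.

Lemma in_disk_notin s w : in_disk s -> 1 < modc w -> w \notin s.
Proof. by move=> ds w1; apply/negP => /ds; rewrite leNgt w1. Qed.

Lemma ler_modc_sumV s w : in_disk s -> 1 < modc w ->
  modc (\sum_(z <- s) (w - z)^-1) <= (size s)%:R / (modc w - 1).
Proof.
move=> ds w1; apply: (le_trans (ler_modc_sum _ _ _)).
rewrite -sum1_size natr_sum mulr_suml big_seq [leRHS]big_seq.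
apply: ler_sum => z zs; rewrite modcV mul1r lef_pV2 ?posrE ?subr_gt0//.
  by apply: le_trans (ler_modcB _ _); rewrite lerB// ds.
by rewrite modc_gt0 subr_eq0 modc_ltP// (le_lt_trans (ds _ zs)).
Qed.

Lemma ler_modc_sumV2 s w : in_disk s -> 1 < modc w ->
  modc (\sum_(z <- s) (w - z)^-1 ^+ 2) <= (size s)%:R / (modc w - 1) ^+ 2.
Proof.
move=> ds w1; apply: (le_trans (ler_modc_sum _ _ _)).
rewrite -sum1_size natr_sum mulr_suml big_seq [leRHS]big_seq.
apply: ler_sum => z zs; rewrite -exprVn modcX modcV mul1r.
have w0 : 0 < modc (w - z).
  by rewrite modc_gt0 subr_eq0 modc_ltP// (le_lt_trans (ds _ zs)).
rewrite ler_pXn2r ?nnegrE ?invr_ge0 ?modc_ge0 ?subr_ge0 ?(ltW w1)//.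
rewrite lef_pV2 ?posrE ?subr_gt0//.
by apply: le_trans (ler_modcB _ _); rewrite lerB// ds.
Qed.

(* Every term satisfies Re (2w / (w - z)) = 1 + poisson w z >= 1. *)
Lemma ger_modc_sumV s w : in_disk s -> 1 < modc w ->
  (size s)%:R / (2 * modc w) <= modc (\sum_(z <- s) (w - z)^-1).
Proof.
move=> ds w1; have w0 : 0 < modc w by rewrite (lt_trans _ w1).
rewrite ler_pdivrMr ?mulr_gt0// mulrC.
have -> : 2 * modc w = modc (2%:R * w) by rewrite modcM modc_nat.
rewrite -modcM; apply: le_trans (le_trans (ler_norm _) (normr_Re_le _)).
rewrite mulr_sumr Re_sum -sum1_size natr_sum big_seq [leRHS]big_seq.
apply: ler_sum => z zs.
have zw : modc z < modc w by rewrite (le_lt_trans (ds _ zs)).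
by rewrite -subr_ge0 -poissonE2 ?modc_ltP// poisson_ge0.
Qed.

End log_derivative.

Section zeros_of_derivative.
Context {R : realType}.
Implicit Types (p : {poly R[i]}) (w z : R[i]).

Lemma horner_zeros p w :
  p.[w] = lead_coef p * \prod_(z <- zeros p) (w - z).
Proof. by rewrite [in LHS](zerosE p) hornerZ horner_prodX. Qed.

Lemma mem_zeros p z : p != 0 -> (z \in zeros p) = root p z.
Proof.
by move=> p0; rewrite [in RHS](zerosE p) rootZ ?lead_coef_eq0// root_prod_XsubC.
Qed.

Lemma deriv_zeros p w : w \notin zeros p ->
  p^`().[w] = p.[w] * \sum_(z <- zeros p) (w - z)^-1.
Proof.
move=> wp; rewrite [in LHS](zerosE p) derivZ hornerZ deriv_prodX// mulrA.
by rewrite -hornerZ -zerosE.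
Qed.

Lemma deriv2_zeros p w : w \notin zeros p ->
  p^`()^`().[w] = p.[w] * ((\sum_(z <- zeros p) (w - z)^-1) ^+ 2 -
                            \sum_(z <- zeros p) (w - z)^-1 ^+ 2).
Proof.
move=> wp; rewrite [in LHS](zerosE p) !derivZ hornerZ deriv2_prodX// mulrA.
by rewrite -hornerZ -zerosE.
Qed.

Lemma horner_neq0 p w : in_disk (zeros p) -> p != 0 -> 1 < modc w -> p.[w] != 0.
Proof.
by move=> dp p0 /(in_disk_notin dp); rewrite mem_zeros.
Qed.

Lemma size_derivC p : size p^`() = (size p).-1.
Proof.
have [->|p0] := eqVneq p 0; first by rewrite deriv0 size_poly0.
have sp : (0 < size p)%N by rewrite size_poly_gt0.
have [s1|s1] := leqP (size p) 1.
  by rewrite (size1_polyC s1) derivC size_poly0 size_polyC; case: (_ == _).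
apply/eqP; rewrite eqn_leq -ltnS (prednK sp) lt_size_deriv//=.
case: (size p) s1 (lead_coefE p) => [|[|n]]//= _ lp.
rewrite ltnNge; apply/negP => /leq_sizeP /(_ n (leqnn _)).
rewrite coef_deriv -lp => /eqP; rewrite mulrn_eq0/= lead_coef_eq0.
exact/negP.
Qed.

(* For |w| > 1 >= |z| every w / (w - z) has positive real part, so the
   logarithmic derivative does not vanish at w. *)
Lemma gauss_lucas p : (1 < size p)%N ->
  in_disk (zeros p) -> in_disk (zeros p^`()).
Proof.
move=> sp dp z; have p0 : p != 0 by rewrite -size_poly_gt0 ltnW.
have p'0 : p^`() != 0 by rewrite -size_poly_gt0 size_derivC -subn1 subn_gt0.
rewrite mem_zeros// leNgt; apply: contraL => z1.
have zp := in_disk_notin dp z1.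
rewrite /root deriv_zeros// mulf_neq0 ?horner_neq0//.
rewrite -modc_gt0 (lt_le_trans _ (ger_modc_sumV dp z1))// divr_gt0//.
  by rewrite size_zeros// ltr0n -subn1 subn_gt0.
by rewrite mulr_gt0// (lt_trans _ z1).
Qed.

(** Comparing p'' = p' L' with p'' = p (L^2 - S) and p' = p L gives L' - L = - S / L, where [L']
    denotes the logarithmic derivative of p'. The upper bound on [S] and the lower bound on [L] are
    both linear in the degree, which therefore cancels. *)
Lemma logderiv_dist p w : (1 < size p)%N -> in_disk (zeros p) -> 1 < modc w ->
  modc (\sum_(z <- zeros p^`()) (w - z)^-1 - \sum_(z <- zeros p) (w - z)^-1) <=
  2 * modc w / (modc w - 1) ^+ 2.
Proof.
move=> sp dp w1; have p0 : p != 0 by rewrite -size_poly_gt0 ltnW.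
have p'0 : p^`() != 0 by rewrite -size_poly_gt0 size_derivC -subn1 subn_gt0.
have wp := in_disk_notin dp w1.
have wp' := in_disk_notin (gauss_lucas sp dp) w1.
have pw := horner_neq0 dp p0 w1.
have p'w := horner_neq0 (gauss_lucas sp dp) p'0 w1.
have := ger_modc_sumV dp w1; have := ler_modc_sumV2 dp w1.
have := deriv_zeros wp'; rewrite deriv2_zeros//.
move: p'w; rewrite deriv_zeros//.
set L' := \sum_(z <- zeros p^`()) _; set L := \sum_(z <- _) _.
set S := \sum_(z <- _) _; rewrite mulf_eq0 negb_or => /andP[_ L0].
rewrite -mulrA => /(mulfI pw) LS.
have -> : L' - L = - S / L.
  apply: (mulfI L0); rewrite mulrBr -LS; field.
  exact: L0.
have n0 : 0 < (size (zeros p))%:R :> R.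
  by rewrite size_zeros// ltr0n -subn1 subn_gt0.
have w0 : 0 < modc w by rewrite (lt_trans _ w1).
have w10 : 0 < modc w - 1 by rewrite subr_gt0.
rewrite modcM modcN modcV => hS hL.
have L00 : 0 < modc L by rewrite modc_gt0.
rewrite ler_pdivrMr//; apply: (le_trans hS).
apply: le_trans (ler_wpM2l _ hL); last by rewrite divr_ge0 ?sqr_ge0// mulr_ge0// ltW.
rewrite le_eqVlt; apply/orP; left; apply/eqP; field.
by rewrite gt_eqF//= gt_eqF.
Qed.

Lemma deriv_ratio_le p w : (1 < size p)%N -> in_disk (zeros p) -> 1 < modc w ->
  modc p^`().[w] <= (size p)%:R / (modc w - 1) * modc p.[w].
Proof.
move=> sp dp w1; have p0 : p != 0 by rewrite -size_poly_gt0 ltnW.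
rewrite deriv_zeros ?in_disk_notin// modcM mulrC ler_wpM2r ?modc_ge0//.
apply: (le_trans (ler_modc_sumV dp w1)); rewrite ler_wpM2r//.
  by rewrite invr_ge0 subr_ge0 ltW.
by rewrite size_zeros// ler_nat leq_pred.
Qed.

End zeros_of_derivative.

Section iterated_derivative.
Context {R : realType}.
Implicit Types (p : {poly R[i]}) (w z : R[i]).

Lemma size_derivnC p k : size p^`(k) = (size p - k)%N.
Proof.
elim: k => [|k IH]; first by rewrite derivn0 subn0.
by rewrite derivnS size_derivC IH subnS.
Qed.

Lemma in_disk_derivn p k : (k < size p)%N ->
  in_disk (zeros p) -> in_disk (zeros p^`(k)).
Proof.
move=> + dp; elim: k => [|k IH] kp; first by rewrite derivn0.
rewrite derivnS; apply: gauss_lucas; last exact: IH (ltnW kp).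
by rewrite size_derivnC ltn_subRL addn1.
Qed.

Lemma logderivn_dist p k w : (k < size p)%N -> in_disk (zeros p) ->
  1 < modc w ->
  modc (\sum_(z <- zeros p^`(k)) (w - z)^-1 - \sum_(z <- zeros p) (w - z)^-1)
  <= (2 * modc w / (modc w - 1) ^+ 2) *+ k.
Proof.
move=> + dp w1; elim: k => [|k IH] kp; first by rewrite derivn0 subrr modc0.
rewrite mulrS -(subrKA (\sum_(z <- zeros p^`(k)) (w - z)^-1)).
apply: le_trans (ler_modcD _ _) _; apply: lerD; last exact: IH (ltnW kp).
rewrite derivnS; apply: logderiv_dist => //; last exact: in_disk_derivn (ltnW kp) _.
by rewrite size_derivnC ltn_subRL addn1.
Qed.

(** Each differentiation costs a factor linear in the degree. The bound is applied at the mirror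
    image of a point of the disk, where a lower bound for the Blaschke product needs an upper bound
    for the derivative. *)
Lemma derivn_ratio_le p k w : (k < size p)%N -> in_disk (zeros p) ->
  1 < modc w ->
  modc p^`(k).[w] <= ((size p)%:R / (modc w - 1)) ^+ k * modc p.[w].
Proof.
move=> + dp w1; elim: k => [|k IH] kp; first by rewrite expr0 mul1r.
have c0 : 0 <= (modc w - 1)^-1 by rewrite invr_ge0 subr_ge0 ltW.
rewrite derivnS; apply: le_trans (deriv_ratio_le _ _ w1) _.
- by rewrite size_derivnC ltn_subRL addn1.
- exact: in_disk_derivn (ltnW kp) _.
rewrite exprS -[leRHS]mulrA; apply: ler_pM; rewrite ?mulr_ge0 ?modc_ge0//.
- by rewrite ler_wpM2r// ler_nat size_derivnC leq_subr.
- exact: IH (ltnW kp).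
Qed.

End iterated_derivative.

(** * Blaschke products *)

Section blaschke.
Context {R : realType}.
Implicit Types (p : {poly R[i]}) (w z : R[i]).

(** The modulus of a Blaschke factor, that is, the pseudo-hyperbolic distance of [w] and [z]. *)
Definition blaschke w z : R := modc (w - z) / modc (1 - conjc w * z).

Lemma blaschke_den_gt0 w z : modc w < 1 -> modc z <= 1 ->
  0 < modc (1 - conjc w * z).
Proof.
move=> w1 z1; rewrite (lt_le_trans _ (ler_modcB _ _))// modc1 subr_gt0.
rewrite modcM modc_conj (le_lt_trans _ w1)//.
by rewrite ler_piMr ?modc_ge0.
Qed.

(* The usual identity for a Blaschke factor: the defect of its modulus from 1
   measures the distance of z from the circle. *)
Lemma blaschke_sq w z : modc w < 1 -> modc z <= 1 ->
  blaschke w z ^+ 2 = 1 - (1 - modc w ^+ 2) * (1 - modc z ^+ 2) /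
    modc (1 - conjc w * z) ^+ 2.
Proof.
move=> w1 z1; have := blaschke_den_gt0 w1 z1.
move=> /lt0r_neq0; rewrite -sqrf_eq0 /blaschke expr_div_n !modc_sq.
by case: w w1 => a b _; case: z z1 => c d _; simpc => /= h; field.
Qed.

(** The denominator in [blaschke_sq] is at most 4, and 1 - x <= exp (- x). The exponential turns the
    product over the zeros into a sum of defects. *)
Lemma blaschke_sq_le w z : modc w < 1 -> modc z <= 1 ->
  blaschke w z ^+ 2 <= expR (- ((1 - modc w ^+ 2) / 4 * (1 - modc z ^+ 2))).
Proof.
move=> w1 z1; apply: le_trans (expR_ge1Dx _).
have d0 := blaschke_den_gt0 w1 z1.
rewrite blaschke_sq// lerD2l lerN2 mulrAC ler_wpM2l//.
  by rewrite mulr_ge0// subr_ge0 exprn_ile1 ?modc_ge0 ?(ltW w1).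
rewrite lef_pV2 ?posrE ?exprn_gt0//.
rewrite (_ : 4 = 2 ^+ 2); last by rewrite -natrX.
rewrite ler_pXn2r ?nnegrE ?modc_ge0//.
apply: le_trans (ler_modcD _ _) _; rewrite modc1 modcN modcM modc_conj.
rewrite -[leRHS]/(1 + 1) lerD2l (le_trans _ (ltW w1))//.
by rewrite ler_piMr ?modc_ge0.
Qed.

(* [1 / conj w] is the mirror image of [w] in the unit circle. *)
Lemma modc_mirror (s : seq R[i]) w : w != 0 ->
  (forall z, z \in s -> modc z = 1) ->
  modc w ^+ size s * modc (\prod_(z <- s) ((conjc w)^-1 - z)) =
  modc (\prod_(z <- s) (w - z)).
Proof.
move=> w0; elim: s => [|x s IH] hs; first by rewrite !big_nil mul1r.
rewrite !big_cons exprS !modcM mulrACA IH; last first.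
  by move=> z zs; rewrite hs// inE zs orbT.
congr (_ * _); rewrite -[X in X * _]modc_conj -modcM mulrBr divff ?conjc_eq0//.
have x1 : modc x = 1 by rewrite hs// inE eqxx.
(* On the circle the conjugate of [x] is its inverse. *)
have -> : 1 - conjc w * x = - x * conjc (w - x).
  rewrite conjcB (conjc_unit x1) mulrBr mulNr mulNr divff; last first.
    by rewrite -modc_eq0 x1 oner_eq0.
  by rewrite opprK addrC mulrC.
by rewrite modcM modcN x1 mul1r modc_conj.
Qed.

(** Identifies the denominator of a Blaschke product with the value at the mirror image of [w],
    wherever the zeros lie. *)
Lemma prod_blaschkeE w (s : seq R[i]) : w != 0 ->
  modc w ^+ size s * modc (\prod_(z <- s) ((conjc w)^-1 - z)) =
  \prod_(z <- s) modc (1 - conjc w * z).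
Proof.
move=> w0; elim: s => [|x s IH]; first by rewrite !big_nil mul1r modc1.
rewrite !big_cons exprS modcM mulrACA IH; congr (_ * _).
by rewrite -[X in X * _]modc_conj -modcM mulrBr divff ?conjc_eq0.
Qed.

(* With Q = p^`(k) and w' the mirror image of w, the Blaschke product of the
   zeros of Q at w equals |Q(w)| / (|w|^(deg Q) |Q(w')|). As p has all its zeros
   on the circle, |p(w)| = |w|^(deg p) |p(w')|, so the product is at least
   [delta] up to a power of the degree; take logarithms. *)
Lemma zeros_near_circle p k w (delta : R) : (k < size p)%N ->
  (forall z, z \in zeros p -> modc z = 1) ->
  w != 0 -> modc w < 1 -> 0 < delta ->
  delta * modc p.[w] <= modc p^`(k).[w] ->
  (1 - modc w ^+ 2) / 4 * \sum_(z <- zeros p^`(k)) (1 - modc z ^+ 2) <=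
  2 * (k%:R * (ln (size p)%:R - ln (1 - modc w)) - ln delta).
Proof.
move=> kp pc w0 w1 delta0 hd; set q := p^`(k).
have p0 : p != 0 by rewrite -size_poly_gt0 (leq_ltn_trans _ kp).
have dp : in_disk (zeros p) by move=> z /pc ->.
have dq : in_disk (zeros q) by exact: in_disk_derivn.
have wm0 : 0 < modc w by rewrite modc_gt0.
have sp0 : 0 < (size p)%:R :> R by rewrite ltr0n (leq_ltn_trans _ kp).
pose w' := (conjc w)^-1.
have mw' : modc w' = (modc w)^-1 by rewrite modcV modc_conj.
have w'1 : 1 < modc w' by rewrite mw' invf_gt1.
set B := \prod_(z <- zeros q) blaschke w z.
have pw'0 : 0 < modc p.[w'] by rewrite modc_gt0 horner_neq0.
have pw0 : modc p.[w] = modc w ^+ size (zeros p) * modc p.[w'].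
  by rewrite !horner_zeros !modcM -modc_mirror// mulrCA.
have q0 : q != 0 by rewrite -size_poly_gt0 size_derivnC subn_gt0.
have qw : modc q.[w] = B * (modc w ^+ size (zeros q) * modc q.[w']).
  have -> : modc w ^+ size (zeros q) * modc q.[w'] =
      modc (lead_coef q) * \prod_(z <- zeros q) modc (1 - conjc w * z).
    by rewrite horner_zeros modcM mulrCA prod_blaschkeE.
  rewrite horner_zeros modcM modc_prod [RHS]mulrCA; congr (_ * _).
  rewrite /B -big_split/= big_seq [RHS]big_seq; apply: eq_bigr => z zq.
  by rewrite /blaschke divfK// gt_eqF// blaschke_den_gt0// dq.
have sz : (size (zeros p) = size (zeros q) + k)%N.
  rewrite !size_zeros// size_derivnC; move: kp; case: (size p) => //= n.
  by rewrite ltnS => kn; rewrite -subn1 subnAC subn1/= subnK.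
have B_ge : delta * (1 - modc w) ^+ k / (size p)%:R ^+ k <= B.
  move: hd; rewrite -/q qw pw0 sz.
  have := derivn_ratio_le kp dp w'1; rewrite -/q => h1 h2.
  have B0 : 0 <= B by apply: prodr_ge0 => z _; rewrite divr_ge0 ?modc_ge0.
  have {}h2 := le_trans h2 (ler_wpM2l B0 (ler_wpM2l (exprn_ge0 _ (ltW wm0)) h1)).
  set D := modc w ^+ size (zeros q) * modc w ^+ k * modc p.[w'].
  have D0 : 0 < D by rewrite !mulr_gt0// exprn_gt0.
  rewrite ler_pdivrMr ?exprn_gt0// -(ler_pM2l D0).
  have w1k : 0 < (1 - modc w) ^+ k by rewrite exprn_gt0// subr_gt0.
  have -> : D * (delta * (1 - modc w) ^+ k) = (1 - modc w) ^+ k *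
      (delta * (modc w ^+ (size (zeros q) + k) * modc p.[w'])).
    rewrite exprD /D; move: (_ ^+ size _) (_ ^+ k) (_ ^+ k) (modc p.[w']).
    by move=> *; ring.
  have h3 := ler_wpM2l (ltW w1k) h2.
  apply: (le_trans h3) => {h2 h3}.
  rewrite le_eqVlt; apply/orP; left; apply/eqP.
  (* The factor |w| on the right, raised to the power k, accounts for the k zeros lost by
     differentiation. *)
  have -> : (size p)%:R / (modc w' - 1) = (size p)%:R * modc w / (1 - modc w).
    by rewrite mw'; field; rewrite ?gt_eqF ?subr_gt0 ?mulf_neq0// ?gt_eqF.
  rewrite exprMn exprVn exprMn /D; move: w1k.
  move: (_ ^+ size _) (modc w ^+ k) (_ ^+ k) (_ ^+ k) (modc p.[w']).
  by move=> x1 x2 x3 x4 x5 x40; field; rewrite gt_eqF.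
have B2 : B ^+ 2 <= expR (- ((1 - modc w ^+ 2) / 4 *
    \sum_(z <- zeros q) (1 - modc z ^+ 2))).
  rewrite mulr_sumr -sumrN expR_sum /B -prodrXl big_seq [leRHS]big_seq.
  by apply: ler_prod => z zq; rewrite sqr_ge0 blaschke_sq_le// dq.
set S := _ * \sum_(z <- _) _ in B2 *.
set c := _ / _ in B_ge.
have c0 : 0 < c by rewrite divr_gt0 ?mulr_gt0 ?exprn_gt0// subr_gt0.
(* The exponential bound concerns squares of Blaschke factors; this is the source of the factor 2 in
   the conclusion. *)
have : ln (c ^+ 2) <= - S.
  rewrite -[leRHS]expRK ler_ln ?posrE ?expR_gt0 ?exprn_gt0//.
  apply: le_trans B2; rewrite ler_pXn2r ?nnegrE ?(ltW c0)//.
  exact: le_trans (ltW c0) B_ge.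
rewrite lnXn// lerNr => /le_trans; apply.
rewrite /c lnM ?posrE ?mulr_gt0 ?invr_gt0 ?exprn_gt0 ?subr_gt0//.
rewrite lnM ?posrE ?exprn_gt0 ?subr_gt0//.
rewrite lnV ?posrE ?exprn_gt0// !lnXn ?subr_gt0//.
rewrite le_eqVlt; apply/orP; left; apply/eqP.
rewrite -[_ *+ 2]mulr_natl -![ln _ *+ k]mulr_natl.
by move: (ln _) (ln _) (ln _) => *; ring.
Qed.

End blaschke.

(** * Averages over the zeros *)

Section average.
Context {R : realType}.
Implicit Types (s : seq R[i]) (F G H : R[i] -> R).

Definition avg s F : R := (\sum_(z <- s) F z) / (size s)%:R.

Lemma avgD s F G : avg s (fun z => F z + G z) = avg s F + avg s G.
Proof. by rewrite /avg big_split/= mulrDl. Qed.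

Lemma avgN s F : avg s (fun z => - F z) = - avg s F.
Proof. by rewrite /avg sumrN mulNr. Qed.

Lemma avgB s F G : avg s (fun z => F z - G z) = avg s F - avg s G.
Proof. by rewrite avgD avgN. Qed.

Lemma avgZ s c F : avg s (fun z => c * F z) = c * avg s F.
Proof. by rewrite /avg -mulr_sumr mulrA. Qed.

Lemma avg_sum (I : Type) (r : seq I) s (F : I -> R[i] -> R) :
  avg s (fun z => \sum_(i <- r) F i z) = \sum_(i <- r) avg s (F i).
Proof. by rewrite /avg exchange_big/= mulr_suml. Qed.

Lemma eq_avg s F G : {in s, F =1 G} -> avg s F = avg s G.
Proof. by move=> FG; rewrite /avg (eq_big_seq _ FG). Qed.

Lemma le_avg s F G : {in s, forall z, F z <= G z} -> avg s F <= avg s G.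
Proof.
move=> FG; rewrite /avg ler_wpM2r ?invr_ge0// big_seq [leRHS]big_seq.
exact: ler_sum.
Qed.

Lemma ler_norm_avg s F : `|avg s F| <= avg s (fun z => `|F z|).
Proof. by rewrite /avg normrM normfV normr_nat ler_wpM2r ?invr_ge0// ler_norm_sum. Qed.

Lemma avg_cst s c : (0 < size s)%N -> avg s (fun=> c) = c.
Proof.
move=> s0; rewrite /avg big_const_seq count_predT iter_addr_0 -[_ *+ _]mulr_natr mulfK//.
by rewrite pnatr_eq0 -lt0n.
Qed.

Lemma perm_avg s t F : perm_eq s t -> avg s F = avg t F.
Proof. by move=> st; rewrite /avg (perm_size st) (perm_big _ st). Qed.

Lemma avg_mkseq (a : nat -> R[i]) n F :
  avg (mkseq a n) F = (\sum_(i < n) F (a i)) / n%:R.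
Proof. by rewrite /avg size_mkseq big_map -val_enum_ord big_map big_enum. Qed.

Lemma avg_poisson s w : w \notin s -> (0 < size s)%N ->
  avg s (poisson w) =
  Re (2%:R * w * \sum_(z <- s) (w - z)^-1) / (size s)%:R - 1.
Proof.
move=> ws s0; rewrite -[X in _ - X](avg_cst 1 s0) /avg -mulrBl; congr (_ / _).
rewrite mulr_sumr Re_sum -sumrB big_seq [RHS]big_seq; apply: eq_bigr => z zs.
by rewrite poissonE2//; apply: contraNneq ws => ->.
Qed.

End average.

Section sample.
Context {R : realType}.
Variable a : nat -> R[i].
Hypothesis a1 : forall i, modc (a i) = 1.
Implicit Types (w z : R[i]).

Lemma size_sample_poly n : size (sample_poly a n) = n.+1.
Proof. by rewrite /sample_poly size_prod_XsubC /index_enum -enumT size_enum_ord. Qed.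

(** The order chosen by [zeros] is unspecified, so unique factorization gives equality only up to a
    permutation. *)
Lemma zeros_sample_poly n : perm_eq (zeros (sample_poly a n)) (mkseq a n).
Proof.
apply: prod_XsubC_eq; have := zerosE (sample_poly a n).
rewrite (monicP (monic_prod_XsubC _ _ _)) scale1r => <-.
rewrite /sample_poly big_map -[in RHS]val_enum_ord big_map big_enum.
exact: eq_bigr.
Qed.

Lemma mem_zeros_sample n z : z \in zeros (sample_poly a n) -> modc z = 1.
Proof. by rewrite (perm_mem (zeros_sample_poly n)) => /mapP[i _ ->]. Qed.

Lemma in_disk_sample n : in_disk (zeros (sample_poly a n)).
Proof. by move=> z /mem_zeros_sample ->. Qed.

Lemma in_disk_derivn_sample n k : (k <= n)%N ->
  in_disk (zeros (sample_poly a n)^`(k)).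
Proof.
by move=> kn; apply: in_disk_derivn (@in_disk_sample n); rewrite size_sample_poly.
Qed.

(** There are two sources of error: the logarithmic derivatives differ by O(1), and the averages are
    normalized by n - k and by n. The second one produces the summand 1 / (|w| - 1). *)
Lemma avg_poisson_dist n k w : (k < n)%N -> 1 < modc w ->
  `|avg (zeros (sample_poly a n)^`(k)) (poisson w) -
    avg (mkseq a n) (poisson w)| <=
  2 * modc w * k%:R * (2 * modc w / (modc w - 1) ^+ 2 + (modc w - 1)^-1) /
  (n - k)%:R.
Proof.
move=> kn w1; have kn' := ltnW kn.
have w0 : 0 < modc w by rewrite (lt_trans _ w1).
rewrite -(perm_avg _ (zeros_sample_poly n)).
have kp : (k < size (sample_poly a n))%N by rewrite size_sample_poly ltnS.
have := logderivn_dist kp (@in_disk_sample n) w1.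
have := ler_modc_sumV (@in_disk_sample n) w1.
rewrite !avg_poisson ?size_zeros_derivn// ?subn_gt0//; first last.
- exact: in_disk_notin (in_disk_derivn_sample kn') w1.
- by rewrite (perm_size (zeros_sample_poly n)) size_mkseq (leq_ltn_trans _ kn).
- exact: in_disk_notin (@in_disk_sample n) w1.
rewrite (perm_size (zeros_sample_poly n)) size_mkseq.
set SZ := \sum_(z <- _) _; set SW := \sum_(z <- _) _ => hZ hWZ.
set A := Re _; set B := Re _.
have n0 : 0 < n%:R :> R by rewrite ltr0n (leq_ltn_trans _ kn).
have m0 : 0 < (n - k)%:R :> R by rewrite ltr0n subn_gt0.
have w10 : 0 < modc w - 1 by rewrite subr_gt0.
have m2w : modc (2%:R * w) = 2 * modc w by rewrite modcM modc_nat.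
have hB : `|B| <= 2 * modc w * (n%:R / (modc w - 1)).
  rewrite (le_trans (normr_Re_le _))// modcM m2w ler_wpM2l//.
  by rewrite mulr_ge0// ltW.
have hAB : `|A - B| <= 2 * modc w * (2 * modc w / (modc w - 1) ^+ 2 *+ k).
  have -> : A - B = Re (2%:R * w * (SW - SZ)).
    by rewrite mulrBr ReB.
  rewrite (le_trans (normr_Re_le _))// modcM m2w ler_wpM2l//.
  by rewrite mulr_ge0// ltW.
have nE : n%:R = (n - k)%:R + k%:R :> R by rewrite -natrD subnK.
have -> : A / (n - k)%:R - 1 - (B / n%:R - 1) =
    (A - B) / (n - k)%:R + B * (k%:R / (n%:R * (n - k)%:R)).
  by field: nE; rewrite !gt_eqF.
rewrite (le_trans (ler_normD _ _))// (normrM (A - B)) (normrM B).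
have im0 : 0 <= (n - k)%:R^-1 :> R by rewrite invr_ge0.
have kn0 : 0 <= k%:R / (n%:R * (n - k)%:R) :> R by rewrite divr_ge0 ?mulr_ge0.
rewrite (ger0_norm im0) (ger0_norm kn0).
apply: le_trans (lerD (ler_wpM2r im0 hAB) (ler_wpM2r kn0 hB)) _.
rewrite -mulr_natl le_eqVlt; apply/orP; left; apply/eqP; field.
by rewrite !gt_eqF.
Qed.

Lemma avg_poisson_cvg k w : 1 < modc w ->
  (fun n => avg (zeros (sample_poly a n)^`(k)) (poisson w) -
            avg (mkseq a n) (poisson w)) @ \oo --> 0.
Proof.
move=> w1; apply/cvgr0Pnorm_le => e e0; near=> n.
have kn : (k < n)%N by near: n; exact: nbhs_infty_gt.
apply: le_trans (avg_poisson_dist kn w1) _.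
rewrite ler_pdivrMr ?ltr0n ?subn_gt0// natrB 1?ltnW// -ler_pdivrMl//.
by rewrite lerBrDr; near: n; exact: nbhs_infty_ger.
Unshelve. all: by end_near. Qed.

(** With delta = (n + 1)^(-B), [zeros_near_circle] bounds the sum of the defects by O(log n), while
    the average divides by n - k. *)
Lemma avg_defect_cvg k w (B : nat) : w != 0 -> modc w < 1 ->
  (\forall n \near \oo, n.+1%:R ^- B * modc (sample_poly a n).[w] <=
                        modc (sample_poly a n)^`(k).[w]) ->
  (fun n => avg (zeros (sample_poly a n)^`(k)) (fun z => 1 - modc z ^+ 2))
    @ \oo --> 0.
Proof.
move=> w0 w1 hB.
pose c : R := (1 - modc w ^+ 2) / 4.
have c0 : 0 < c by rewrite divr_gt0// subr_gt0 exprn_ilt1 ?modc_ge0.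
have wm0 : 0 < modc w by rewrite modc_gt0.
pose L := ln (1 - modc w).
(* With s = sqrt (n + 1) and ln (n + 1) <= 2 s, the bound from [zeros_near_circle] is at most K s.
   The [M] below is such that M <= s implies K s <= c e (n - k). *)
pose K : R := 4 * (k%:R + B%:R) + 2 * k%:R * `|L|.
apply/cvgr0Pnorm_le => e e0; pose M := (K + c * e * k.+1%:R) / (c * e).
have ce0 : 0 < c * e by rewrite mulr_gt0.
have K0 : 0 <= K by rewrite /K addr_ge0// mulr_ge0// addr_ge0.
have M0 : 0 <= M by rewrite /M divr_ge0 ?(ltW ce0)// addr_ge0// mulr_ge0 ?(ltW ce0).
near=> n.
have kn : (k < n)%N by near: n; exact: nbhs_infty_gt.
have m0 : 0 < (n - k)%:R :> R by rewrite ltr0n subn_gt0.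
have n0 : 0 < n.+1%:R :> R by rewrite ltr0n.
rewrite ger0_norm; last first.
  rewrite /avg divr_ge0// big_seq sumr_ge0// => z zs.
  by rewrite subr_ge0 exprn_ile1 ?modc_ge0// (in_disk_derivn_sample (ltnW kn)).
rewrite /avg size_zeros_derivn 1?ltnW// ler_pdivrMr//.
rewrite -(ler_pM2l c0).
apply: le_trans (zeros_near_circle (p := sample_poly a n) _ _ w0 w1
  (delta := n.+1%:R ^- B) _ _) _.
- by rewrite size_sample_poly ltnS ltnW.
- exact: mem_zeros_sample.
- by rewrite invr_gt0 exprn_gt0.
- by near: n.
rewrite size_sample_poly lnV ?posrE ?exprn_gt0// lnXn// opprK.
set l : R := ln n.+1%:R.
pose s : R := Num.sqrt n.+1%:R.
have s0 : 0 < s by rewrite sqrtr_gt0.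
have s2 : s ^+ 2 = n.+1%:R by rewrite sqr_sqrtr// ltW.
have ls : l <= 2 * s.
  rewrite /l -s2 lnXn// -[leLHS]mulr_natl ler_pM2l//.
  rewrite (le_trans _ (_ : s - 1 <= s)) ?gerBl//.
  have := @le_ln1Dx R (s - 1); rewrite addrCA subrr addr0; apply.
  by rewrite ltrBrDr addNr.
have s1 : 1 <= s by rewrite -sqrtr1 ler_wsqrtr// ler1n.
have Ms : M <= s.
  rewrite -(ler_pXn2r (n := 2)) ?nnegrE ?(ltW s0)// s2.
  rewrite (@le_trans _ _ n%:R)// ?ler_nat//; near: n; exact: nbhs_infty_ger.
move: Ms; rewrite ler_pdivrMr// => Ms.
have nk : (n - k)%:R = s ^+ 2 - k.+1%:R :> R.
  by rewrite s2 -[in RHS]natrB ?ltnS 1?ltnW// subSS.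
have Ls : - L <= `|L| by rewrite lerNl; exact: lerNnormlW.
have kBl : (k%:R + B%:R) * l <= (k%:R + B%:R) * (2 * s).
  by rewrite ler_wpM2l// addr_ge0.
have kL : k%:R * - L <= k%:R * `|L| * s.
  by rewrite -mulrA ler_wpM2l// (le_trans Ls)// ler_peMr.
have := ler_wpM2r (ltW s0) Ms.
have : c * e * k.+1%:R <= c * e * k.+1%:R * s by rewrite ler_peMr// mulr_ge0 ?(ltW ce0).
rewrite nk /K => h1 h2; rewrite -/L.
by nra.
Unshelve. all: by end_near. Qed.

End sample.

(** * Approximation by Poisson kernels *)

Section complex_topology.
Context {R : realType}.
Implicit Types z w : R[i].

(** The norm of [(R[i])^o] has values in [R[i]]; this passes to real radii. *)
Lemma nbhs_modcP (z : (R[i])^o) (A : set (R[i])^o) :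
  nbhs z A <-> exists2 e : R, 0 < e & forall w, modc (z - w) < e -> A w.
Proof.
split=> [/nbhs_ballP[e /= e0 zA]|[e e0 zA]].
  have eR : e = (Re e)%:C by rewrite RRe_real// gtr0_real.
  exists (Re e); first by rewrite -ltcR -eR.
  by move=> w zw; apply: zA; rewrite -ball_normE/= eR modcE ltcR.
apply/nbhs_ballP; exists e%:C; first by rewrite /= ltcR.
by move=> w; rewrite -ball_normE/= modcE ltcR; exact: zA.
Qed.

Lemma modc_continuous (f : (R[i])^o -> R) :
  (forall z (e : R), 0 < e -> exists2 d, 0 < d &
    forall w, modc (z - w) < d -> `|f z - f w| < e) -> continuous f.
Proof.
move=> h z.
have [_] := @cvgrPdist_lt R R _ (nbhs (z : (R[i])^o)) _ f (f z).
apply=> e e0; apply/(@nbhs_modcP z).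
by have [d d0 hd] := h z e e0; exists d.
Qed.

Lemma lipschitz_continuous (f : (R[i])^o -> R) :
  (forall z w, `|f z - f w| <= modc (z - w)) -> continuous f.
Proof.
move=> h; apply: modc_continuous => z e e0; exists e => // w.
exact: le_lt_trans.
Qed.

Lemma Re_continuous : continuous (@Re R : (R[i])^o -> R).
Proof. by apply: lipschitz_continuous => z w; rewrite -ReB normr_Re_le. Qed.

Lemma Im_continuous : continuous (@Im R : (R[i])^o -> R).
Proof.
apply: lipschitz_continuous => z w.
by rewrite (_ : _ - _ = Im (z - w)) ?normr_Im_le//; case: z; case: w.
Qed.

(** Lets compactness arguments in the plane be carried out on products of real segments. *)
Lemma mkcomplex_continuous :
  continuous ((fun p => p.1 +i* p.2) : R * R -> (R[i])^o).
Proof.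
move=> p; apply/cvgrPdist_lt => e e0.
have eR : e = (Re e)%:C by rewrite RRe_real// gtr0_real.
have {}e0 : 0 < Re e by rewrite -ltcR -eR.
have e20 : 0 < Re e / 2 by rewrite divr_gt0.
have h1 : \forall q \near p, `|p.1 - q.1| < Re e / 2.
  have /cvgrPdist_lt h : q.1 @[q --> p] --> p.1 by exact: cvg_fst.
  exact: h.
have h2 : \forall q \near p, `|p.2 - q.2| < Re e / 2.
  have /cvgrPdist_lt h : q.2 @[q --> p] --> p.2 by exact: cvg_snd.
  exact: h.
near=> q; rewrite eR modcE ltcR; apply: le_lt_trans (modc_le _) _.
by rewrite [ltRHS]splitr/= ltrD//; near: q.
Unshelve. all: by end_near. Qed.

(* Uniform continuity and boundedness in one estimate; the square makes the
   last term cancel the denominator of the Poisson kernel in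
   [poisson_approx]. *)
Lemma modulus_of_continuity (f : (R[i])^o -> R) (e : R) :
  continuous f -> 0 < e -> exists2 C, 0 <= C &
  forall z w, modc z <= 2 -> modc w <= 2 ->
    `|f z - f w| <= e + C * modc (z - w) ^+ 2.
Proof.
move=> cf e0.
pose F (p : R * R) : R := f (p.1 +i* p.2).
have cF : continuous F.
  by move=> p; exact: (continuous_comp (@mkcomplex_continuous p) (cf _)).
pose g (p : (R * R) * (R * R)) : R := `|F p.1 - F p.2|.
have cg : continuous g.
  move=> p; apply: cvg_norm; apply: cvgB.
    exact: (continuous_comp (@cvg_fst _ _ _ _ _) (cF _)).
  exact: (continuous_comp (@cvg_snd _ _ _ _ _) (cF _)).
pose h (p : (R * R) * (R * R)) : R :=
  (p.1.1 - p.2.1) ^+ 2 + (p.1.2 - p.2.2) ^+ 2.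
have ch : continuous h.
  have c1 : continuous (fun p : (R * R) * (R * R) => p.1.1 - p.2.1).
    move=> p; apply: cvgB.
      exact: (continuous_comp (@cvg_fst _ _ _ _ _) (@cvg_fst _ _ _ _ _)).
    exact: (continuous_comp (@cvg_snd _ _ _ _ _) (@cvg_fst _ _ _ _ _)).
  have c2 : continuous (fun p : (R * R) * (R * R) => p.1.2 - p.2.2).
    move=> p; apply: cvgB.
      exact: (continuous_comp (@cvg_fst _ _ _ _ _) (@cvg_snd _ _ _ _ _)).
    exact: (continuous_comp (@cvg_snd _ _ _ _ _) (@cvg_snd _ _ _ _ _)).
  move=> p; apply: cvgD.
    exact: (continuous_comp (c1 p) (@exprn_continuous R 2 _)).
  exact: (continuous_comp (c2 p) (@exprn_continuous R 2 _)).
pose I : set R := `[-2, 2]%classic.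
have cI : compact I by exact: segment_compact.
(* Off the compact set [D] of pairs at which f varies by at least e, the term [e] suffices. On [D]
   the two points are distinct, so the squared distance [h] has a positive minimum, and max g / min
   h serves as [C]. *)
pose D := ((I `*` I) `*` (I `*` I)) `&` (g @^-1` [set x | e <= x]).
have cD : compact D.
  apply: compact_closedI; first by do ![apply: compact_setX => //].
  by move/continuous_closedP : cg; apply; exact: closed_ge.
have mD z w : modc z <= 2 -> modc w <= 2 -> e < `|f z - f w| ->
  D ((Re z, Im z), (Re w, Im w)).
  move=> z2 w2 fzw; split; last first.
    by rewrite /= /g /F/=; case: z z2 fzw => ? ? _; case: w w2 => ? ? _ /ltW.
  rewrite /I; split; split => /=; rewrite in_itv/= -ler_norml.
  - exact: le_trans (normr_Re_le _) z2.
  - exact: le_trans (normr_Im_le _) z2.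
  - exact: le_trans (normr_Re_le _) w2.
  - exact: le_trans (normr_Im_le _) w2.
have [D0|/set0P D0] := eqVneq D set0.
  exists 0 => // z w z2 w2; rewrite mul0r addr0 leNgt; apply/negP => /(mD _ _ z2 w2).
  by rewrite D0.
have [p pD hp] := compact_EVT_min D0 cD (continuous_subspaceT ch).
have [q qD gq] := compact_EVT_max D0 cD (continuous_subspaceT cg).
have hp0 : 0 < h p.
  have := pD; rewrite inE => -[_]; rewrite lt_def addr_ge0 ?sqr_ge0// andbT.
  rewrite /= /g => /(lt_le_trans e0); apply: contraTneq => /eqP.
  rewrite /h paddr_eq0 ?sqr_ge0// !sqrf_eq0 !subr_eq0 => /andP[/eqP p1 /eqP p2].
  by rewrite /F p1 p2 subrr normr0 ltxx.
have C0 : 0 <= g q / h p.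
  by apply: divr_ge0; [exact: normr_ge0|exact: ltW].
exists (g q / h p) => //.
move=> z w z2 w2; have [|/(mD _ _ z2 w2)zwD] := leP `|f z - f w| e.
  by move=> /le_trans; apply; rewrite lerDl mulr_ge0 ?sqr_ge0.
have := hp _ (mem_set zwD); have := gq _ (mem_set zwD).
move=> gz hz; apply: (@le_trans _ _ (g q)).
  by move: gz; rewrite /g /F/=; case: (z) (w) => ? ? [].
apply: (@le_trans _ _ (g q / h p * modc (z - w) ^+ 2)); last by rewrite lerDr ltW.
rewrite mulrAC ler_pdivlMr// ler_wpM2l//; first exact: normr_ge0.
by apply: (le_trans hz); rewrite modc_sq /h/=; case: (z) (w) => ? ? [].
Qed.

End complex_topology.

Section poisson_approximation.
Context {R : realType}.
Implicit Types z w : R[i].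

Definition radius l : R := 1 + l.+1%:R^-1.

(* The zeros of X^(M+1) - rho^(M+1), i.e. equally spaced points on the circle
   of radius rho = radius l. *)
Definition nodes l M : seq R[i] :=
  zeros ('X^(M.+1) - ((radius l)%:C ^+ M.+1)%:P).

Lemma radius_gt1 l : 1 < radius l.
Proof. by rewrite ltrDl invr_gt0 ltr0n. Qed.

Lemma radius_le2 l : radius l <= 2.
Proof. by rewrite -[leRHS]/(1 + 1) lerD2l invf_le1 ?ltr0n// ler1n. Qed.

Lemma node_poly_neq0 l M :
  'X^(M.+1) - ((radius l)%:C ^+ M.+1)%:P != 0 :> {poly R[i]}.
Proof. by rewrite -size_poly_eq0 size_XnsubC. Qed.

Lemma size_nodes l M : size (nodes l M) = M.+1.
Proof. by rewrite size_zeros ?node_poly_neq0// size_XnsubC. Qed.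

Lemma modc_node l M w : w \in nodes l M -> modc w = radius l.
Proof.
rewrite mem_zeros ?node_poly_neq0// /root !hornerE subr_eq0 => /eqP wM.
have r0 : 0 <= radius l by rewrite (le_trans _ (ltW (radius_gt1 l))).
have := congr1 modc wM; rewrite !modcX modc_real ger0_norm// => /eqP.
by rewrite eqrXn2 ?modc_ge0// => /eqP.
Qed.

Lemma node_gt z l M w : modc z <= 1 -> w \in nodes l M -> modc z < modc w.
Proof.
by move=> z1 wn; rewrite (modc_node wn) (le_lt_trans z1)// radius_gt1.
Qed.

(* The logarithmic derivative of 'X^(M.+1) - (radius l) ^+ M.+1. *)
Lemma sumV_nodes z l M : modc z <= 1 ->
  \sum_(w <- nodes l M) (z - w)^-1 =
  M.+1%:R * z ^+ M / (z ^+ M.+1 - (radius l)%:C ^+ M.+1).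
Proof.
move=> z1; have zn : z \notin nodes l M.
  by apply/negP => zn; have := node_gt z1 zn; rewrite ltxx.
have := deriv_zeros zn; move: zn; rewrite mem_zeros ?node_poly_neq0// /root.
rewrite -/(nodes l M) derivB derivXn derivC subr0 hornerMn !hornerE /=.
rewrite -[_ *+ M.+1]mulr_natl => h0 ->; rewrite mulrAC divff ?mul1r//.
Qed.

(** As 2w / (w - z) = 2 - 2z / (z - w), the error is given by the sum of the 1 / (z - w), which
    [sumV_nodes] evaluates in closed form; it is small because |z| <= 1 < [radius l]. *)
Lemma avg_nodes_poisson z l M : modc z <= 1 ->
  `|avg (nodes l M) (fun w => poisson w z) - 1| <= 2 / (radius l ^+ M.+1 - 1).
Proof.
move=> z1; have r0 : 0 <= radius l by rewrite (le_trans _ (ltW (radius_gt1 l))).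
have rM : 0 < radius l ^+ M.+1 - 1.
  by rewrite subr_gt0 exprn_egt1// radius_gt1.
have -> : avg (nodes l M) (fun w => poisson w z) - 1 =
    - avg (nodes l M) (fun w => Re (2%:R * z / (z - w))).
  rewrite -[X in _ - X](@avg_cst _ (nodes l M) 1) ?size_nodes// -avgB -avgN.
  apply: eq_avg => w wn /=.
  have wz := modc_ltP (node_gt z1 wn); rewrite poissonE2// -!addrA.
  have -> : 2%:R * w / (w - z) = 2%:R - 2%:R * z / (z - w).
    have zw : z != w by rewrite eq_sym.
    by field; rewrite !subr_eq0 wz zw.
  by rewrite ReB/=; ring.
rewrite normrN /avg -Re_sum -mulr_sumr sumV_nodes// size_nodes.
have zr : modc (z ^+ M.+1 - (radius l)%:C ^+ M.+1) >= radius l ^+ M.+1 - 1.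
  rewrite modcBC (le_trans _ (ler_modcB _ _))// !modcX modc_real ger0_norm//.
  by rewrite lerD2l lerN2 exprn_ile1// modc_ge0.
rewrite normrM normfV normr_nat ler_pdivrMr ?ltr0n//.
apply: (le_trans (normr_Re_le _)).
rewrite !modcM modcV !modc_nat modcX.
have -> : 2 * modc z * (M.+1%:R * modc z ^+ M /
    modc (z ^+ M.+1 - (radius l)%:C ^+ M.+1)) =
    2 * (modc z ^+ M.+1 / modc (z ^+ M.+1 - (radius l)%:C ^+ M.+1) * M.+1%:R).
  by rewrite (exprS (modc z)); move: (modc (_ - _))^-1 (_ ^+ M) => *; ring.
rewrite -[leRHS]mulrA ler_wpM2l//.
rewrite ler_wpM2r// -[leRHS]mul1r ler_pM ?exprn_ge0 ?modc_ge0//.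
- by rewrite invr_ge0 modc_ge0.
- by rewrite exprn_ile1 ?modc_ge0.
- by rewrite lef_pV2// posrE (lt_le_trans rM).
Qed.

(** The kernel averages to nearly 1 over the nodes, so it remains to average |f z - f w| against it.
    In the bound e / 4 + C |z - w|^2 the square cancels the denominator of the kernel and leaves C
    (rho^2 - |z|^2), with rho the radius of the nodes: the defect of z up to C (rho^2 - 1). *)
Lemma poisson_approx (f : (R[i])^o -> R) (e : R) : continuous f -> 0 < e ->
  exists l M, exists2 C, 0 <= C & forall z, modc z <= 1 ->
    `|f z - avg (nodes l M) (fun w => f w * poisson w z)| <=
    e + C * (1 - modc z ^+ 2).
Proof.
move=> cf e0; have e40 : 0 < e / 4 by rewrite divr_gt0.
have [C C0 hC] := modulus_of_continuity cf e40.
pose B := `|f 0| + e / 4 + C.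
have B0 : 0 <= B by rewrite /B !addr_ge0 ?(ltW e40).
have fB z : modc z <= 1 -> `|f z| <= B.
  move=> z1; have := hC z 0.
  rewrite modc0 subr0 => /(_ (le_trans z1 (ler1n _ 2)) (ler0n _ 2)) h.
  rewrite -[f z](subrK (f 0)) (le_trans (ler_normD _ _))// addrC /B -addrA lerD2l.
  by rewrite (le_trans h)// lerD2l ler_piMr// exprn_ile1// modc_ge0.
have [l hl] : exists l, C * (radius l ^+ 2 - 1) <= e / 4.
  (* The 3 comes from (1 + x)^2 - 1 <= 3 x for 0 <= x <= 1. *)
  have x0 : 0 <= C * 3 / (e / 4) by rewrite divr_ge0 ?(ltW e40)// mulr_ge0.
  exists (Num.bound (C * 3 / (e / 4))); set l := Num.bound _.
  have := archi_boundP x0; rewrite ltr_pdivrMr// -/l => hl.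
  have l0 : 0 < l.+1%:R :> R by rewrite ltr0n.
  apply: (@le_trans _ _ (C * 3 / l.+1%:R)); last first.
    rewrite ler_pdivrMr// (le_trans (ltW hl))// mulrC ler_wpM2l ?(ltW e40)//.
    by rewrite ler_nat.
  rewrite -mulrA ler_wpM2l// /radius.
  have : l.+1%:R^-1 <= 1 :> R by rewrite invf_le1// ler1n.
  have : 0 <= l.+1%:R^-1 :> R by rewrite invr_ge0.
  by move: (l.+1%:R^-1) => x *; nra.
(* The first entry keeps the average [A] of the kernel at most 2; the second makes |f z| |A - 1| at
   most e / 4. *)
pose D := Num.max 2 (B * 2 / (e / 4)).
have [M hM] : exists M, D <= radius l ^+ M.+1 - 1.
  have D0 : 0 <= D by rewrite /D le_max ler0n.
  have l0 : 0 < l.+1%:R :> R by rewrite ltr0n.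
  have bernoulli n : 1 + n%:R * l.+1%:R^-1 <= radius l ^+ n.
    elim: n => [|n IH]; first by rewrite mul0r addr0 expr0.
    rewrite exprSr (le_trans _ (ler_wpM2r _ IH))//; last first.
      by rewrite (le_trans _ (ltW (radius_gt1 l))).
    rewrite /radius -natr1; have : 0 <= l.+1%:R^-1 :> R by rewrite invr_ge0.
    have : 0 <= n%:R :> R by [].
    by move: (l.+1%:R^-1) (n%:R) => x y *; nra.
  exists (Num.bound (D * l.+1%:R)); set M := Num.bound _.
  rewrite lerBrDl (le_trans _ (bernoulli _))// lerD2l ler_pdivlMr//.
  have := archi_boundP (mulr_ge0 D0 (ltW l0)); rewrite -/M => /ltW/le_trans; apply.
  by rewrite ler_nat.
have rM0 : 0 < radius l ^+ M.+1 - 1.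
  by rewrite (lt_le_trans _ hM)// /D lt_max ltr0n.
have rM1 : 2 / (radius l ^+ M.+1 - 1) <= 1.
  by rewrite ler_pdivrMr// mul1r (le_trans _ hM)// /D le_max lexx.
have rMB : B * (2 / (radius l ^+ M.+1 - 1)) <= e / 4.
  rewrite mulrA ler_pdivrMr// -ler_pdivrMl// mulrC (le_trans _ hM)//.
  by rewrite /D le_max lexx orbT.
exists l, M, C => // z z1.
have r2 w : w \in nodes l M -> modc w <= 2.
  by move=> /modc_node ->; exact: radius_le2.
have z2 : modc z <= 2 by rewrite (le_trans z1)// ler1n.
have := avg_nodes_poisson l M z1; set A := avg _ _ => hA.
have A0 : A <= 2.
  by rewrite -lerBlDr (le_trans (ler_norm _))// (le_trans hA).
have -> : f z - avg (nodes l M) (fun w => f w * poisson w z) =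
    avg (nodes l M) (fun w => (f z - f w) * poisson w z) - f z * (A - 1).
  rewrite mulrBr mulr1 -avgZ opprB addrCA -avgB; congr (_ + _).
  by rewrite -avgN; apply: eq_avg => w _ /=; ring.
rewrite (le_trans (ler_normB _ _))// (normrM (f z)).
have h1 : `|f z| * `|A - 1| <= e / 4.
  by rewrite (le_trans _ rMB)// ler_pM// fB.
have h2 : `|avg (nodes l M) (fun w => (f z - f w) * poisson w z)| <=
    e / 4 * 2 + C * (radius l ^+ 2 - modc z ^+ 2).
  apply: (le_trans (ler_norm_avg _ _)).
  apply: (@le_trans _ _ (avg (nodes l M) (fun w =>
    e / 4 * poisson w z + C * (radius l ^+ 2 - modc z ^+ 2)))).
    apply: le_avg => w wn /=; have zw := node_gt z1 wn.
    have P0 := poisson_ge0 zw.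
    rewrite normrM (ger0_norm P0).
    apply: (le_trans (ler_wpM2r P0 (hC z w z2 (r2 w wn)))).
    rewrite mulrDl lerD2l -mulrA ler_wpM2l//.
    rewrite poissonE ?modc_ltP// (modc_node wn) modcBC mulrC divfK//.
    by rewrite sqrf_eq0 modc_eq0 subr_eq0 modc_ltP.
  rewrite avgD avgZ avg_cst ?size_nodes// lerD2r ler_wpM2l ?(ltW e40)//.
apply: le_trans (lerD h2 h1) _; move: hl.
by move: (radius l ^+ 2) (modc z ^+ 2) => x y *; lra.
Qed.

End poisson_approximation.

(** * The deterministic limit *)

Section deterministic_limit.
Context {R : realType}.
Variable a : nat -> R[i].
Hypothesis a1 : forall i, modc (a i) = 1.

Lemma cvg_sum0 (T : eqType) (r : seq T) (u : T -> nat -> R) :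
  (forall i, i \in r -> u i @ \oo --> 0) ->
  (fun n => \sum_(i <- r) u i n) @ \oo --> 0.
Proof.
elim: r => [_|i r IH h].
  rewrite (_ : (fun=> _) = fun=> 0); first exact: cvg_cst.
  by apply/funext => n; rewrite big_nil.
rewrite (_ : (fun n => _) = u i \+ (fun n => \sum_(j <- r) u j n)); last first.
  by apply/funext => n; rewrite big_cons.
rewrite -[X in _ --> X]addr0; apply: cvgD; first by apply: h; rewrite inE eqxx.
by apply: IH => j jr; apply: h; rewrite inE jr orbT.
Qed.

Lemma cvgZ0 (u : nat -> R) c :
  u @ \oo --> 0 -> (fun n => c * u n) @ \oo --> 0.
Proof.
by move=> u0; rewrite -[X in _ --> X](mulr0 c); apply: cvgM => //; exact: cvg_cst.
Qed.

Lemma avg_derivn_zeros_cvg (f : (R[i])^o -> R) k w (B : nat) : continuous f ->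
  w != 0 -> modc w < 1 ->
  (\forall n \near \oo, n.+1%:R ^- B * modc (sample_poly a n).[w] <=
                        modc (sample_poly a n)^`(k).[w]) ->
  (fun n => avg (zeros (sample_poly a n)^`(k)) f - avg (mkseq a n) f)
    @ \oo --> 0.
Proof.
move=> cf w0 w1 hB; apply/cvgr0Pnorm_le => e e0.
have e40 : 0 < e / 4 by rewrite divr_gt0.
have [l [M [C C0 hf]]] := poisson_approx cf e40.
pose ns : seq R[i] := nodes l M; rewrite -/ns in hf.
pose g z := avg (ns) (fun w => f w * poisson w z).
have cg : (fun n => avg (zeros (sample_poly a n)^`(k)) g - avg (mkseq a n) g)
    @ \oo --> 0.
  have gE s : avg s g = \sum_(v <- ns)
      f v / (size ns)%:R * avg s (poisson v).
    transitivity (avg s (fun z => \sum_(v <- ns)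
        f v / (size ns)%:R * poisson v z)).
      apply: eq_avg => z _; rewrite /g /avg mulr_suml; apply: eq_bigr => v _.
      by rewrite mulrAC.
    by rewrite avg_sum; apply: eq_bigr => v _; rewrite avgZ.
  under eq_fun do rewrite !gE -sumrB.
  apply: cvg_sum0 => v vn; under eq_fun do rewrite -mulrBr.
  by apply: cvgZ0; apply: avg_poisson_cvg => //; rewrite (modc_node vn) radius_gt1.
have /cvgr0Pnorm_le /(_ (e / 4) e40) hg := cg.
have hd := avg_defect_cvg a1 w0 w1 hB.
have /cvgr0Pnorm_le /(_ (e / 4) e40) hCd : (fun n => C *
    avg (zeros (sample_poly a n)^`(k)) (fun z => 1 - modc z ^+ 2)) @ \oo --> 0.
  exact: cvgZ0 hd.
near=> n.
have kn : (k < n)%N by near: n; exact: nbhs_infty_gt.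
have hg' : `|avg (zeros (sample_poly a n)^`(k)) g - avg (mkseq a n) g| <= e / 4.
  by near: n; exact: hg.
have hCd' : `|C * avg (zeros (sample_poly a n)^`(k))
    (fun z => 1 - modc z ^+ 2)| <= e / 4.
  by near: n; exact: hCd.
set W := zeros _ in hg' hCd' *.
have W0 : (0 < size W)%N by rewrite size_zeros_derivn ?subn_gt0// ltnW.
have hW : `|avg W (fun z => f z - g z)| <= e / 4 + e / 4.
  apply: (le_trans (ler_norm_avg _ _)).
  apply: (@le_trans _ _ (avg W (fun z => e / 4 + C * (1 - modc z ^+ 2)))).
    by apply: le_avg => z zW; exact: hf _ (in_disk_derivn_sample a1 (ltnW kn) zW).
  rewrite avgD avg_cst// avgZ lerD2l.
  exact: le_trans (ler_norm _) hCd'.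
(* The samples lie on the circle, where the defect term of [hf] vanishes. *)
have hZ : `|avg (mkseq a n) (fun z => f z - g z)| <= e / 4.
  apply: (le_trans (ler_norm_avg _ _)).
  apply: (@le_trans _ _ (avg (mkseq a n) (fun=> e / 4))).
    apply: le_avg => z /mapP[i _ ->]; have := hf (a i).
    by rewrite a1 expr1n subrr mulr0 addr0; apply.
  by rewrite avg_cst// size_mkseq (leq_ltn_trans _ kn).
rewrite !avgB in hW hZ.
move: hW hZ hg'; rewrite !ler_norml => /andP[? ?] /andP[? ?] /andP[? ?].
by apply/andP; split; lra.
Unshelve. all: by end_near. Qed.

End deterministic_limit.

(** * The ratio of a derivative to the polynomial inside the disk *)

Section ratio.
Context {R : realType}.
Implicit Types (w z b p : R[i]).

Lemma derivn_mulXsubC (p : {poly R[i]}) c k :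
  (p * ('X - c%:P))^`(k.+1) = p^`(k.+1) * ('X - c%:P) + p^`(k) *+ k.+1.
Proof.
elim: k => [|k IH]; first by rewrite !derivnS !derivn0 derivM derivXsubC mulr1.
rewrite derivnS IH derivD derivM derivXsubC mulr1 derivMn -!derivnS.
by rewrite -addrA -mulrS.
Qed.

Lemma sample_polyS (a : nat -> R[i]) n :
  sample_poly a n.+1 = sample_poly a n * ('X - (a n)%:P).
Proof. by rewrite /sample_poly big_ord_recr. Qed.

(** Where the polynomial does not vanish, this is k! times the k-th elementary symmetric polynomial
    in the 1 / (w - a i) with i < n. *)
Definition deriv_ratio (a : nat -> R[i]) w k n : R[i] :=
  (sample_poly a n)^`(k).[w] / (sample_poly a n).[w].

(** Beyond first order in [b], every term of the binomial expansion has at most k factors [p], each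
    of size O(N). The induction multiplies the remainder by p + b. *)
Lemma powD_remainder (c : R) k : 0 <= c -> exists K : R,
  forall (N : R) p b, 1 <= N -> modc p <= c * N -> modc b <= c ->
  modc ((p + b) ^+ k.+2 - p ^+ k.+2 - k.+2%:R * b * p ^+ k.+1) <= K * N ^+ k.
Proof.
move=> c0; elim: k => [|k [K hK]].
  exists (c ^+ 2) => N p b N1 pN bc; rewrite expr0 mulr1 expr1.
  have -> : (p + b) ^+ 2 - p ^+ 2 - 2%:R * b * p = b ^+ 2 by ring.
  by rewrite modcX ler_pXn2r ?nnegrE ?modc_ge0.
exists (2 * c * K + k.+2%:R * c ^+ k.+3) => N p b N1 pN bc.
have N0 : 0 <= N by rewrite (le_trans _ N1).
have -> : (p + b) ^+ k.+3 - p ^+ k.+3 - k.+3%:R * b * p ^+ k.+2 =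
    (p + b) * ((p + b) ^+ k.+2 - p ^+ k.+2 - k.+2%:R * b * p ^+ k.+1) +
    k.+2%:R * (b ^+ 2 * p ^+ k.+1).
  by rewrite !exprS; move: (_ ^+ k) (_ ^+ k) => *; ring.
apply: (le_trans (ler_modcD _ _)); rewrite [leRHS]mulrDl; apply: lerD.
  have pb : modc (p + b) <= 2 * c * N.
    apply: (le_trans (ler_modcD _ _)).
    have : c * 1 <= c * N by rewrite ler_wpM2l.
    by rewrite mulr1 => ?; lra.
  rewrite modcM (le_trans (ler_pM _ _ pb (hK _ _ _ N1 pN bc))) ?modc_ge0//.
  rewrite exprS le_eqVlt; apply/orP; left; apply/eqP.
  by move: (N ^+ k) => *; ring.
rewrite (modcM k.+2%:R) (modcM (b ^+ 2)) modc_nat !modcX -[leRHS]mulrA ler_wpM2l//.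
have -> : c ^+ k.+3 * N ^+ k.+1 = c ^+ 2 * (c * N) ^+ k.+1.
  by rewrite exprMn !exprS; move: (_ ^+ k) (_ ^+ k) => *; ring.
apply: ler_pM; rewrite ?exprn_ge0 ?modc_ge0//.
  by rewrite lerXn2r// nnegrE modc_ge0.
by rewrite lerXn2r// nnegrE ?modc_ge0// mulr_ge0.
Qed.

Variable a : nat -> R[i].
Hypothesis a1 : forall i, modc (a i) = 1.
Variable w : R[i].
Hypothesis w1 : modc w < 1.

Local Notation r := (deriv_ratio a w).
Local Notation b n := (w - a n)^-1.
Local Notation p n := (\sum_(i < n) b i).

Lemma sub_sample_neq0 n : w - a n != 0.
Proof. by rewrite subr_eq0; apply: contraTneq w1 => ->; rewrite a1 ltxx. Qed.

Lemma sample_poly_neq0 n : (sample_poly a n).[w] != 0.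
Proof.
elim: n => [|n IH]; first by rewrite /sample_poly big_ord0 hornerC oner_eq0.
by rewrite sample_polyS hornerM hornerXsubC mulf_neq0// sub_sample_neq0.
Qed.

Lemma deriv_ratio0 n : r 0%N n = 1.
Proof. by rewrite /deriv_ratio derivn0 divff// sample_poly_neq0. Qed.

Lemma deriv_ratioS0 k : r k.+1 0%N = 0.
Proof.
by rewrite /deriv_ratio /sample_poly big_ord0 derivnC horner0 mul0r.
Qed.

Lemma deriv_ratioSS k n : r k.+1 n.+1 = r k.+1 n + k.+1%:R * b n * r k n.
Proof.
rewrite /deriv_ratio sample_polyS derivn_mulXsubC !hornerD !hornerM hornerMn.
rewrite hornerXsubC -[_ *+ k.+1]mulr_natl; field.
by rewrite sample_poly_neq0 sub_sample_neq0.
Qed.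

Lemma modc_b_le n : modc (b n) <= (1 - modc w)^-1.
Proof.
rewrite modcV lef_pV2 ?posrE ?subr_gt0// ?modc_gt0 ?sub_sample_neq0//.
by rewrite modcBC (le_trans _ (ler_modcB _ _))// a1.
Qed.

Lemma modc_p_le n : modc (p n) <= (1 - modc w)^-1 * n%:R.
Proof.
apply: (le_trans (ler_modc_sum _ _ _)).
apply: (@le_trans _ _ (\sum_(i < n) (1 - modc w)^-1)).
  by apply: ler_sum => i _; exact: modc_b_le.
by rewrite sumr_const card_ord mulr_natr.
Qed.

(** In passing from n to n + 1 samples, the ratio of order k + 2 and the power p^(k+2) grow by (k +
    2) b times the ratio of order k + 1 and times p^(k+1), the latter up to O(n^k). By induction on
    k these increments differ by O(n^k), and n of them add up to O(n^(k+1)). *)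
Lemma deriv_ratio_dist k : exists K : R,
  forall n, modc (r k.+1 n - p n ^+ k.+1) <= K * n.+1%:R ^+ k.
Proof.
pose c := (1 - modc w)^-1.
have c0 : 0 <= c by rewrite invr_ge0 subr_ge0 ltW.
elim: k => [|k [K hK]].
  exists 0 => n; rewrite mul0r expr1; suff -> : r 1%N n = p n.
    by rewrite subrr modc0.
  elim: n => [|n IH]; first by rewrite deriv_ratioS0 big_ord0.
  by rewrite deriv_ratioSS IH big_ord_recr/= deriv_ratio0 mulr1 mul1r.
have [D hD] := powD_remainder k c0.
pose L := k.+2%:R * c * K + D; exists `|L| => n.
apply: (@le_trans _ _ (n%:R * (`|L| * n.+1%:R ^+ k))); last first.
  by rewrite exprS mulrCA ler_wpM2l// ler_wpM2r ?exprn_ge0// ler_nat.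
elim: n => [|n IH].
  by rewrite deriv_ratioS0 big_ord0 exprS mul0r subr0 modc0 mul0r.
have pn : modc (p n) <= c * n.+1%:R.
  by rewrite (le_trans (modc_p_le n))// ler_wpM2l// ler_nat.
have := hD n.+1%:R (p n) (b n) (ler1n _ _) pn (modc_b_le n).
have := hK n.
have -> : r k.+2 n.+1 - p n.+1 ^+ k.+2 = (r k.+2 n - p n ^+ k.+2) +
  (k.+2%:R * b n * (r k.+1 n - p n ^+ k.+1) -
  ((p n + b n) ^+ k.+2 - p n ^+ k.+2 - k.+2%:R * b n * p n ^+ k.+1)).
  by rewrite deriv_ratioSS [\sum_(i < n.+1) _]big_ord_recr/=; ring.
move=> h1 h2; apply: (le_trans (ler_modcD _ _)).
have nN : n.+1%:R ^+ k <= n.+2%:R ^+ k :> R.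
  by rewrite lerXn2r ?nnegrE// ler_nat.
apply: (@le_trans _ _ (n%:R * (`|L| * n.+1%:R ^+ k) + `|L| * n.+1%:R ^+ k)).
  apply: lerD => //; apply: (le_trans (ler_modcD _ _)); rewrite modcN.
  apply: (@le_trans _ _ (L * n.+1%:R ^+ k)); last first.
    by rewrite ler_wpM2r ?exprn_ge0// ler_norm.
  rewrite /L [leRHS]mulrDl; apply: lerD h2.
  rewrite !modcM modc_nat -!mulrA ler_wpM2l//.
  by rewrite ler_pM ?modc_ge0// modc_b_le.
rewrite -[X in _ + X]mul1r -mulrDl natr1 ler_wpM2l//.
by rewrite ler_wpM2l.
Qed.

(** For positive order k + 1 the main term p^(k+1) has order n^(k+1), whereas the error in
    [deriv_ratio_dist] is only O(n^k). *)
Lemma deriv_ratio_ge1 k (eta : R) : 0 < eta ->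
  (\forall n \near \oo, eta * n%:R <= modc (p n)) ->
  \forall n \near \oo, 1 <= modc (r k n).
Proof.
move=> eta0 hp; case: k => [|k].
  by near=> n; rewrite deriv_ratio0 modc1.
have [K hK] := deriv_ratio_dist k.
near=> n.
have n1 : (1 <= n)%N by near: n; exact: nbhs_infty_ge.
have nR : 1 <= n%:R :> R by rewrite ler1n.
have hn : (1 + `|K| * 2 ^+ k) / eta ^+ k.+1 <= n%:R.
  by near: n; exact: nbhs_infty_ger.
have hp' : eta * n%:R <= modc (p n) by near: n; exact: hp.
have n2 : n.+1%:R ^+ k <= 2 ^+ k * n%:R ^+ k :> R.
  rewrite -exprMn lerXn2r ?nnegrE ?mulr_ge0// -natr1 mulrDl mul1r lerD2l//.
have {}hK : modc (r k.+1 n - p n ^+ k.+1) <= `|K| * 2 ^+ k * n%:R ^+ k.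
  apply: (le_trans (hK n)); rewrite -mulrA.
  apply: (@le_trans _ _ (`|K| * n.+1%:R ^+ k)).
    by rewrite ler_wpM2r ?exprn_ge0// ler_norm.
  by rewrite ler_wpM2l.
have hpk : eta ^+ k.+1 * n%:R * n%:R ^+ k <= modc (p n ^+ k.+1).
  rewrite -mulrA -exprS -exprMn modcX lerXn2r ?nnegrE ?modc_ge0//.
  by rewrite mulr_ge0// ltW.
have := ler_modcB (p n ^+ k.+1) (p n ^+ k.+1 - r k.+1 n).
rewrite opprB addrCA subrr addr0 modcBC => h.
have nk : 1 <= n%:R ^+ k :> R by rewrite exprn_ege1.
move: hn; rewrite ler_pdivrMr ?exprn_gt0// [_%:R * _]mulrC => hn.
have := ler_wpM2r (le_trans ler01 nk) hn; rewrite mulrDl mul1r => hn'.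
apply: le_trans h; rewrite lerBrDr (le_trans _ hpk)// (le_trans _ hn')//.
by rewrite lerD.
Unshelve. all: by end_near. Qed.

Lemma deriv_ratioP k n (x : R) :
  x <= modc (r k n) ->
  x * modc (sample_poly a n).[w] <= modc (sample_poly a n)^`(k).[w].
Proof.
rewrite /deriv_ratio modcM modcV ler_pdivlMr// modc_gt0.
exact: sample_poly_neq0.
Qed.

End ratio.

(** * Power sums of the samples and the logarithmic derivative near 0 *)

Section moments.
Context {R : realType}.
Implicit Types (w z : R[i]).

(** On the circle inversion is conjugation, so the negative powers in the expansion of 1 / (w - z)
    can be traded for positive moments. *)
Lemma modc_sum_conj (n m : nat) (a : nat -> R[i]) :
  (forall i, modc (a i) = 1) ->
  modc (\sum_(i < n) (a i)^-1 ^+ m) = modc (\sum_(i < n) a i ^+ m).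
Proof.
move=> a1; rewrite -[RHS]modc_conj; congr modc.
rewrite (rmorph_sum (@conjc R)); apply: eq_bigr => i _.
by rewrite -(conjc_unit (a1 i)) (rmorphXn (@conjc R)).
Qed.

(** The left-hand side is the modulus of the exact remainder (w / z)^m / (w - z), and |w - z| >= 1 /
    2. *)
Lemma geometric_expansion w z m : modc w <= 1 / 2 -> modc z = 1 ->
  modc ((w - z)^-1 + \sum_(j < m) w ^+ j * z^-1 ^+ j.+1) <= 2 * modc w ^+ m.
Proof.
move=> w2 z1; have z0 : z != 0 by rewrite -modc_eq0 z1 oner_eq0.
have wz0 : w - z != 0.
  by rewrite subr_eq0; apply: contraTneq w2 => ->; rewrite z1 -ltNge; lra.
have -> : (w - z)^-1 + \sum_(j < m) w ^+ j * z^-1 ^+ j.+1 =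
    (w - z)^-1 * (w / z) ^+ m.
  elim: m => [|m IH]; first by rewrite big_ord0 addr0 expr0 mulr1.
  rewrite big_ord_recr/= addrA IH exprMn exprMn !exprS.
  by move: (w ^+ m) (_ ^+ m) => *; field; rewrite z0 wz0.
rewrite !modcM modcX modcM !modcV z1 invr1 mulr1 ler_wpM2r ?exprn_ge0 ?modc_ge0//.
rewrite -[2]invrK lef_pV2 ?posrE ?invr_gt0// ?modc_gt0//.
by rewrite modcBC (le_trans _ (ler_modcB _ _))// z1; lra.
Qed.

(** Expand each 1 / (w - a i) in powers of w; w^j carries the moment of order j + 1. The terms with
    j < m are o(n), the one with j = m has size about c |w|^m n, and the remainder has a further
    factor |w|, so a small w makes the term j = m dominate. *)
Lemma moments_lower_bound (a : nat -> R[i]) m (c : R) :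
  (forall i, modc (a i) = 1) -> 0 < c ->
  (forall j, (j < m)%N ->
    (fun n => modc (\sum_(i < n) a i ^+ j.+1) / n%:R) @ \oo --> 0) ->
  (fun n => modc (\sum_(i < n) a i ^+ m.+1) / n%:R) @ \oo --> c ->
  exists w, [/\ w != 0, modc w < 1 & exists2 eta, 0 < eta &
    \forall n \near \oo, eta * n%:R <= modc (\sum_(i < n) (w - a i)^-1)].
Proof.
(* As t <= c / 4, the remainder is at most (c / 2) t^m n. The term j = m is eventually at least (3 c
   / 4) t^m n and the earlier ones at most (c / 8) t^m n, which leaves (c / 8) t^m n. *)
move=> a1 c0 hj hm; pose t := Num.min c 1 / 4.
have t0 : 0 < t by rewrite divr_gt0// lt_min c0 ltr01.
have tc : t <= c / 4 by rewrite ler_wpM2r// ge_min lexx.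
have t4 : t <= 1 / 4 by rewrite ler_wpM2r// ge_min lexx orbT.
pose w := t%:C; have wt : modc w = t by rewrite modc_real gtr0_norm.
exists w; split; [by rewrite -modc_gt0 wt|by rewrite wt; lra|].
have tm0 : 0 < t ^+ m by rewrite exprn_gt0.
have eta0 : 0 < t ^+ m * c / 8 by rewrite divr_gt0// mulr_gt0.
exists (t ^+ m * c / 8) => //.
have /cvgr0Pnorm_le/(_ _ eta0) hs : (fun n => \sum_(j < m)
    modc (\sum_(i < n) a i ^+ j.+1) / n%:R) @ \oo --> 0.
  by apply: cvg_sum0 => j _; exact: hj.
have c40 : 0 < c / 4 by rewrite divr_gt0.
have /cvgrPdist_le/(_ _ c40) hm' := hm.
near=> n.
have n0 : 0 < n%:R :> R by rewrite ltr0n; near: n; exact: nbhs_infty_gt.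
have hsn : \sum_(j < m) modc (\sum_(i < n) a i ^+ j.+1) <= t ^+ m * c / 8 * n%:R.
  rewrite -ler_pdivrMr// mulr_suml (le_trans (ler_norm _))//.
  by near: n; exact: hs.
have hmn : c * 3 / 4 * n%:R <= modc (\sum_(i < n) a i ^+ m.+1).
  rewrite -ler_pdivlMr//.
  have : `|c - modc (\sum_(i < n) a i ^+ m.+1) / n%:R| <= c / 4.
    by near: n; exact: hm'.
  by rewrite ler_norml => /andP[_]; lra.
pose S j := \sum_(i < n) (a i)^-1 ^+ j.+1.
have SE j : modc (S j) = modc (\sum_(i < n) a i ^+ j.+1) by exact: modc_sum_conj.
pose E := \sum_(i < n) ((w - a i)^-1 + \sum_(j < m.+1) w ^+ j * (a i)^-1 ^+ j.+1).
have hE : modc E <= n%:R * (2 * t ^+ m.+1).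
  apply: (le_trans (ler_modc_sum _ _ _)).
  apply: (@le_trans _ _ (\sum_(i < n) 2 * t ^+ m.+1)).
    apply: ler_sum => i _; rewrite -[X in 2 * X ^+ _]wt; apply: geometric_expansion => //.
    by rewrite wt; lra.
  by rewrite sumr_const card_ord -[_ *+ n]mulr_natl.
have pE : \sum_(i < n) (w - a i)^-1 =
    E - \sum_(j < m) w ^+ j * S j - w ^+ m * S m.
  rewrite /E big_split/= exchange_big/= big_ord_recr/=.
  under [X in _ = _ + (X + _) - _ - _]eq_bigr do rewrite -mulr_sumr.
  by rewrite -mulr_sumr -/(S m); ring.
have hj' : modc (\sum_(j < m) w ^+ j * S j) <=
    \sum_(j < m) modc (\sum_(i < n) a i ^+ j.+1).
  apply: (le_trans (ler_modc_sum _ _ _)); apply: ler_sum => j _.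
  rewrite modcM SE modcX wt ler_piMl ?modc_ge0// exprn_ile1// ?ltW//.
  by lra.
rewrite pE modcBC (le_trans _ (ler_modcB _ _))//.
rewrite modcM modcX wt SE lerBrDr.
have hN : modc (- \sum_(j < m) w ^+ j * S j) <= t ^+ m * c / 8 * n%:R.
  by rewrite modcN (le_trans hj').
have hB := le_trans (ler_modcD E _) (lerD hE hN).
apply: (le_trans (lerD (lexx _) hB)).
have := ler_wpM2l (ltW tm0) hmn; apply: le_trans.
rewrite exprS.
have : t * (t ^+ m * n%:R) <= c / 4 * (t ^+ m * n%:R).
  by rewrite ler_wpM2r// mulr_ge0// ltW.
move: (t ^+ m) tm0 => x x0 h.
have : x * n%:R * c >= 0 by rewrite !mulr_ge0// ltW.
by nra.
Unshelve. all: by end_near. Qed.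

End moments.

(** * The strong law of large numbers *)

Section bounded_integrable.
Context d (T : measurableType d) (R : realType).

Lemma bounded_integrable (m : {measure set T -> \bar R}) (g : T -> R) (M : R) :
  (m setT < +oo)%E -> measurable_fun setT g -> (forall x, `|g x| <= M) ->
  m.-integrable setT (EFin \o g).
Proof.
move=> mT mg gM; apply: measurable_bounded_integrable => //.
exists M; split; first by rewrite num_real.
by move=> x Mx y _ /=; rewrite (le_trans (gM _))// ltW.
Qed.

Lemma probability_lty (P : probability T R) : (P setT < +oo)%E.
Proof. by rewrite probability_setT ltry. Qed.

Lemma integral_cst_probability (P : probability T R) (c : R) :
  (\int[P]_x c%:E = c%:E)%E.
Proof.
rewrite (integral_cst P measurableT) -[RHS]mule1; congr (_ * _)%E.
exact: probability_setT.
Qed.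

End bounded_integrable.

Section independent_pair.
Context d d1 d2 (T : measurableType d) (T1 : measurableType d1)
  (T2 : measurableType d2) (R : realType).
Variables (P : probability T R) (m1 : probability T1 R) (m2 : probability T2 R).
Variables (X : {mfun T >-> T1}) (Y : {mfun T >-> T2}).
Hypothesis XY : forall A B, measurable A -> measurable B ->
  P ((X @^-1` A) `&` (Y @^-1` B)) = (m1 A * m2 B)%E.

Definition pair_fun t := (X t, Y t).

Lemma measurable_pair_fun : measurable_fun setT pair_fun.
Proof. by apply/measurable_fun_pair; exact: measurable_funPT. Qed.

HB.instance Definition _ :=
  isMeasurableFun.Build _ _ _ _ pair_fun measurable_pair_fun.

Lemma law_pair_fun S : measurable S ->
  P (pair_fun @^-1` S) = (m1 \x m2)%E S.
Proof.
by move=> mS; rewrite (product_measure_unique (m' := distribution P pair_fun)).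
Qed.

Lemma integral_pair_fun (h1 : T1 -> R) (h2 : T2 -> R) (M : R) :
  measurable_fun setT h1 -> measurable_fun setT h2 ->
  (forall x, `|h1 x| <= M) -> (forall x, `|h2 x| <= M) ->
  (\int[P]_t (h1 (X t) * h2 (Y t))%:E =
   \int[m1]_x (h1 x)%:E * \int[m2]_y (h2 y)%:E)%E.
Proof.
move=> mh1 mh2 h1M h2M; pose h (xy : T1 * T2) := h1 xy.1 * h2 xy.2.
have mh : measurable_fun setT h.
  by apply: measurable_funM; apply: measurableT_comp.
have hM xy : `|h xy| <= M * M by rewrite normrM ler_pM.
have h1int : m1.-integrable setT (EFin \o h1).
  exact: bounded_integrable (probability_lty _) mh1 h1M.
have h2int : m2.-integrable setT (EFin \o h2).
  exact: bounded_integrable (probability_lty _) mh2 h2M.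
have hPint : P.-integrable setT (EFin \o (h \o pair_fun)).
  apply: bounded_integrable (probability_lty _) _ (fun t => hM (pair_fun t)).
  exact: measurableT_comp.
have hmint : (m1 \x m2)%E.-integrable setT (EFin \o h).
  apply: bounded_integrable mh hM.
  have := product_measure1E m1 m2 measurableT measurableT.
  rewrite setXTT => h12; rewrite [ltLHS](_ : _ = 1%E) ?ltry//.
  apply: etrans h12 _; rewrite -[RHS]mule1.
  by congr (_ * _)%E; exact: probability_setT.
transitivity (\int[m1 \x m2]_z (h z)%:E)%E; last first.
  rewrite -integral12_prod_meas1//.
  have hE x : (fubini_F m2 (EFin \o h) x =
      (h1 x)%:E * \int[m2]_y (h2 y)%:E)%E.
    rewrite /fubini_F /= -integralZl//.
  under eq_integral do rewrite hE.
  have : (\int[m2]_y (h2 y)%:E)%E \is a fin_num by exact: integral_fune_fin_num.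
  move=> /fineK <-; rewrite integralZr//.
have <- := @integral_distribution _ _ _ _ _ P pair_fun
  (EFin \o h) (measurableT_comp (@EFin_measurable _ _) mh) hPint.
by apply: eq_measure_integral => A mA _; exact: law_pair_fun.
Qed.

End independent_pair.

Section series_of_squares.
Context {R : realType}.

Lemma sum_inv_sq_le n : \sum_(0 <= m < n) (m.+1%:R ^- 2 : R) <= 2.
Proof.
(* Strengthened for the induction: 1 / x^2 <= 2 / x - 2 / (x + 1) for x >= 1 telescopes. *)
have h : \sum_(0 <= m < n) (m.+1%:R ^- 2 : R) <= 2 - 2 / n.+1%:R.
  elim: n => [|n IH]; first by rewrite big_geq// divr1 subrr.
  rewrite big_nat_recr//= (le_trans (lerD IH (lexx _)))//.
  have key : n.+1%:R ^- 2 <= 2 / n.+1%:R - 2 / n.+2%:R :> R.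
    rewrite -[n.+2%:R]natr1; have : 1 <= n.+1%:R :> R by rewrite ler1n.
    move: n.+1%:R => x x1; rewrite -subr_ge0.
    have -> : 2 / x - 2 / (x + 1) - x ^- 2 = (x - 1) / (x ^+ 2 * (x + 1)).
      by field; rewrite !gt_eqF//; lra.
    by apply: divr_ge0; [lra|apply: mulr_ge0; [exact: sqr_ge0|lra]].
  by move: key; move: (2 / n.+1%:R) (2 / n.+2%:R) (_ ^- 2) => *; lra.
by apply: (le_trans h); rewrite gerBl divr_ge0.
Qed.

Lemma nneseries_inv_sq_lty (K : R) : 0 <= K ->
  (\sum_(m <oo) (K * m.+1%:R ^- 2)%:E < +oo)%E.
Proof.
move=> K0; apply: (@le_lt_trans _ _ (K * 2)%:E); last exact: ltry.
apply: lime_le.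
  by apply: is_cvg_nneseries => m _ _; rewrite lee_fin mulr_ge0// invr_ge0 exprn_ge0.
apply: nearW => n; rewrite sumEFin lee_fin -mulr_sumr ler_wpM2l//.
exact: sum_inv_sq_le.
Qed.

Lemma nneseries_lty_cvg0 (u : nat -> R) : (forall m, 0 <= u m) ->
  (\sum_(m <oo) (u m)%:E < +oo)%E -> u @ \oo --> 0.
Proof.
move=> u0 su; have u0' m : (0 <= (u m)%:E)%E by rewrite lee_fin.
have := nneseries_tail_cvg su (fun k _ => u0' k).
move=> h; suff : (EFin \o u) @ \oo --> 0%:E by move/fine_cvg.
apply: (squeeze_cvge _ (cvg_cst 0%E) h); near=> n.
rewrite u0'/= (nneseries_split n 1)// addn1 big_nat1 leeDl//.
exact: nneseries_ge0.
Unshelve. all: by end_near. Qed.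

(* Consecutive squares m^2 <= n < (m+1)^2 differ by O(m) = o(n). *)
Lemma partial_sums_along_squares (h : nat -> R) (M : R) :
  (forall i, `|h i| <= M) ->
  (fun m => ((\sum_(i < m.+1 ^ 2) h i) / (m.+1 ^ 2)%:R) ^+ 2) @ \oo --> 0 ->
  (fun n => (\sum_(i < n) h i) / n%:R) @ \oo --> 0.
Proof.
move=> hM hsq; have M0 : 0 <= M by rewrite (le_trans _ (hM 0%N)).
apply/cvgr0Pnorm_le => e e0.
have e2 : 0 < e / 2 by rewrite divr_gt0.
have /cvgr0Pnorm_le/(_ _ (exprn_gt0 2 e2))[N _ hN] := hsq.
near=> n.
have n0 : (0 < n)%N by near: n; exact: nbhs_infty_gt.
have nR : 0 < n%:R :> R by rewrite ltr0n.
have [m mn nm] : exists2 m, (m ^ 2 <= n)%N & (n < m.+1 ^ 2)%N.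
  have ex : exists m, (m ^ 2 <= n)%N by exists 0%N.
  have bd m : (m ^ 2 <= n)%N -> (m <= n)%N.
    move=> m2; apply: leq_trans m2; case: m => // m.
    by rewrite expnS expn1 leq_pmulr.
  case: (ex_maxnP ex bd) => m mn hm; exists m => //.
  by rewrite ltnNge; apply/negP => /hm; rewrite ltnn.
have mbig : (N.+1 + Num.bound (4 * M / e) < m.+1)%N.
  rewrite -(@ltn_exp2r _ _ 2)// (leq_ltn_trans _ nm)//.
  by near: n; exact: nbhs_infty_ge.
case: m => [|m] in mn nm mbig *; first by rewrite addSn in mbig.
have mR : 0 < m.+1%:R :> R by rewrite ltr0n.
have hm : `|\sum_(i < m.+1 ^ 2) h i| <= e / 2 * (m.+1 ^ 2)%:R.
  rewrite -ler_pdivrMr ?ltr0n ?expn_gt0//.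
  have : `|((\sum_(i < m.+1 ^ 2) h i) / (m.+1 ^ 2)%:R) ^+ 2| <= (e / 2) ^+ 2.
    by apply: hN => /=; move: mbig; rewrite addSn !ltnS => /(leq_trans (leq_addr _ _)).
  rewrite normrX ler_pXn2r ?nnegrE ?normr_ge0 ?(ltW e2)//.
  by rewrite normrM normfV normr_nat.
have sumE : \sum_(i < n) h i = \sum_(i < m.+1 ^ 2) h i +
    \sum_(m.+1 ^ 2 <= i < n) h i.
  by rewrite -!(big_mkord xpredT h) -big_cat_nat.
have htail : `|\sum_(m.+1 ^ 2 <= i < n) h i| <= M * (2 * m.+1%:R).
  apply: (le_trans (ler_norm_sum _ _ _)).
  apply: (@le_trans _ _ (\sum_(m.+1 ^ 2 <= i < n) M)).
    by apply: ler_sum => i _.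
  rewrite sumr_const_nat -[leLHS]mulr_natr ler_wpM2l// -natrM ler_nat.
  rewrite leq_subLR -ltnS (leq_trans nm)// -[m.+2]addn1 sqrnD.
  by rewrite exp1n muln1 addnAC addn1.
have hMm : M * (2 * m.+1%:R) <= e / 2 * n%:R.
  apply: (@le_trans _ _ (e / 2 * (m.+1 ^ 2)%:R)); last first.
    by rewrite ler_wpM2l ?(ltW e2)// ler_nat.
  have : 4 * M / e <= m.+1%:R.
    have x0 : 0 <= 4 * M / e by rewrite divr_ge0 ?(ltW e0)// mulr_ge0.
    rewrite (le_trans (ltW (archi_boundP x0)))// ler_nat -ltnS.
    by rewrite (leq_trans _ mbig)// ltnS leq_addl.
  rewrite ler_pdivrMr// natrX; move: (m.+1%:R) mR => x x0 hx.
  by nra.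
rewrite normrM normfV normr_nat ler_pdivrMr// sumE.
apply: (le_trans (ler_normD _ _)).
have : e / 2 * (m.+1 ^ 2)%:R <= e / 2 * n%:R.
  by rewrite ler_wpM2l ?(ltW e2)// ler_nat.
move: hm htail hMm; move: `|_| `|_| => x y *; lra.
Unshelve. all: by end_near. Qed.

End series_of_squares.

Section strong_law.
Context d d' (T : measurableType d) (T' : measurableType d') (R : realType).
Variables (P : probability T R) (X : nat -> {RV P >-> T'}).
Variable mu : probability T' R.
Hypothesis iidX : iid_with_law P X mu.

Lemma iid_law n A : measurable A -> P (X n @^-1` A) = mu A.
Proof. by move=> mA; rewrite -(iidX.2 n A mA). Qed.

Lemma iid_pair i j A B : i != j -> measurable A -> measurable B ->
  P ((X i @^-1` A) `&` (X j @^-1` B)) = (mu A * mu B)%E.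
Proof.
move=> ij mA mB; pose F l := if l == i then A else B.
have mF l : measurable (F l) by rewrite /F; case: ifP.
have uij : uniq [:: i; j] by rewrite /= inE ij.
have := iidX.1 _ _ uij mF; rewrite !big_cons big_nil mule1 !iid_law//.
rewrite /F eqxx eq_sym (negbTE ij) => <-; congr (P _).
apply/seteqP; split => t /=.
  move=> [tA tB] l /=; rewrite !inE => /orP[/eqP ->|/eqP ->].
    by rewrite eqxx.
  by rewrite eq_sym (negbTE ij).
move=> h; split.
  by have := h i; rewrite /= inE eqxx; apply.
by have := h j; rewrite /= !inE eqxx orbT eq_sym (negbTE ij); apply.
Qed.

(** Second moment method: by pairwise independence the centred sum S_n has E[S_n^2] = O(n). Along
    the squares n = (m + 1)^2 the second moments of S_n / n are summable, which gives almost sure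
    convergence there; [partial_sums_along_squares] fills the gaps. *)
Lemma slln (g : T' -> R) (M : R) :
  measurable_fun setT g -> (forall x, `|g x| <= M) ->
  {ae P, forall w, (fun n => (\sum_(i < n) g (X i w)) / n%:R) @ \oo -->
    (\int[mu]_x g x)%R}.
Proof.
move=> mg gM; set c := (\int[mu]_x g x)%R.
pose h x := g x - c; pose M' := M + `|c|.
have M0 : 0 <= M by rewrite (le_trans _ (gM point)).
have M'0 : 0 <= M' by rewrite addr_ge0.
have mh : measurable_fun setT h by apply: measurable_funB => //; exact: measurable_cst.
have hM x : `|h x| <= M' by rewrite (le_trans (ler_normB _ _))// lerD2r.
have ig : mu.-integrable setT (EFin \o g).
  exact: bounded_integrable (probability_lty _) mg gM.
have h0 : (\int[mu]_x (h x)%:E = 0)%E.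
  under eq_integral do rewrite EFinB.
  rewrite integralB//; last first.
    exact: (bounded_integrable (M := `|c|) (probability_lty _)).
  rewrite integral_cst_probability.
  rewrite /c /Rintegral fineK ?subee//; exact: integrable_fin_num.
have mhX i : measurable_fun setT (h \o X i) by exact: measurableT_comp.
have hXX i j : measurable_fun setT (fun w => h (X i w) * h (X j w)).
  exact: measurable_funM (mhX i) (mhX j).
have iXX i j : P.-integrable setT (EFin \o (fun w => h (X i w) * h (X j w))).
  apply: (bounded_integrable (M := M' * M') (probability_lty _)) => // w.
  by rewrite normrM ler_pM.
have EXX i j : (\int[P]_w (h (X i w) * h (X j w))%:E <=
    ((i == j)%:R * (M' * M'))%:E)%E.
  have [ij|ij] := eqVneq i j.
    rewrite mul1r; apply: (@le_trans _ _ (\int[P]_w (M' * M')%:E)%E).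
      apply: le_integral => //; first exact: iXX.
        exact: (bounded_integrable (M := `|M' * M'|) (probability_lty _)).
      move=> w _; rewrite lee_fin (le_trans (ler_norm _))// normrM.
      by rewrite ler_pM.
    by rewrite integral_cst_probability.
  rewrite mul0r (integral_pair_fun (m1 := mu) (m2 := mu) _ mh mh hM hM).
    by rewrite h0 mul0e.
  by move=> A B mA mB; exact: iid_pair.
pose S n w := \sum_(i < n) h (X i w).
have mS n : measurable_fun setT (S n) by apply: measurable_sum => i; exact: mhX.
have ES n : (\int[P]_w (S n w ^+ 2)%:E <= (n%:R * (M' * M'))%:E)%E.
  have SE w : ((S n w ^+ 2)%:E = \sum_(i < n) \sum_(j < n)
      (h (X i w) * h (X j w))%:E)%E.
    rewrite expr2 /S mulr_suml -sumEFin; apply: eq_bigr => i _.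
    by rewrite mulr_sumr -sumEFin.
  under eq_integral do rewrite SE.
  rewrite integral_sum//; last first.
    by move=> i; apply: integrable_sum => // j _; exact: iXX.
  apply: (@le_trans _ _ (\sum_(i < n) (M' * M')%:E)%E); last first.
    by rewrite sumEFin lee_fin sumr_const card_ord [leRHS]mulr_natl.
  apply: lee_sum => i _; rewrite integral_sum//; last by move=> j; exact: iXX.
  apply: (@le_trans _ _ (\sum_(j < n) ((i == j)%:R * (M' * M'))%:E)%E).
    by apply: lee_sum => j _; exact: EXX.
  rewrite sumEFin lee_fin -mulr_suml (bigD1 i)//= eqxx big1 ?addr0 ?mul1r//.
  by move=> j ji; rewrite eq_sym (negbTE ji).
pose Y m w := ((S (m.+1 ^ 2)%N w) / (m.+1 ^ 2)%:R) ^+ 2.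
have mY m : measurable_fun setT (Y m).
  apply: measurable_funX; apply: measurable_funM => //; exact: measurable_cst.
have Y0 m w : 0 <= Y m w by exact: sqr_ge0.
have EY m : (\int[P]_w (Y m w)%:E <= ((M' * M') * m.+1%:R ^- 2)%:E)%E.
  have YE w : ((Y m w)%:E = ((m.+1 ^ 2)%:R ^- 2)%:E * (S (m.+1 ^ 2)%N w ^+ 2)%:E)%E.
    by rewrite /Y -EFinM expr_div_n mulrC.
  under eq_integral do rewrite YE.
  have S0 w : [set: T] w -> (0 <= (S (m.+1 ^ 2)%N w ^+ 2)%:E)%E.
    by rewrite lee_fin sqr_ge0.
  have mS2 : measurable_fun setT (fun w => (S (m.+1 ^ 2)%N w ^+ 2)%:E).
    by apply/measurable_EFinP; apply: measurable_funX; exact: mS.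
  have c0 : 0 <= (m.+1 ^ 2)%:R ^- 2 :> R by rewrite invr_ge0 exprn_ge0.
  rewrite (ge0_integralZl_EFin _ measurableT S0 mS2 c0).
  apply: (le_trans (lee_wpmul2l _ (ES _))).
    by rewrite lee_fin invr_ge0 exprn_ge0.
  rewrite -EFinM lee_fin natrX le_eqVlt; apply/orP; left; apply/eqP.
  have : m.+1%:R != 0 :> R by rewrite pnatr_eq0.
  by move: m.+1%:R => x x0; field.
(* [F] has finite expectation, hence is finite almost surely, and then its terms tend to 0. *)
pose F w := (\sum_(m <oo) (Y m w)%:E)%E.
have mF : measurable_fun setT F.
  apply: ge0_emeasurable_sum => [m w _ _|m _]; first by rewrite lee_fin.
  exact/measurable_EFinP.
have F0 w : (0 <= F w)%E by apply: nneseries_ge0 => m _ _; rewrite lee_fin.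
have iF : P.-integrable setT F.
  apply/integrableP; split => //.
  under eq_integral do rewrite gee0_abs//.
  rewrite /F integral_nneseries//; last first.
  - by move=> m w _; rewrite lee_fin.
  - by move=> m; apply/measurable_EFinP.
  apply: le_lt_trans (nneseries_inv_sq_lty (mulr_ge0 M'0 M'0)).
  apply: lee_nneseries => [m *|m *]; last exact: EY.
  by apply: integral_ge0 => w _; rewrite lee_fin.
have := integrable_ae measurableT iF.
apply: filterS => w /(_ I) Fw.
have : (F w < +oo)%E by rewrite -ge0_fin_numE.
move=> /(nneseries_lty_cvg0 (Y0 ^~ w)) Yw.
have := partial_sums_along_squares (fun i => hM (X i w)) Yw.
move=> /cvgr0Pnorm_le hw; apply/cvgrPdist_le => e e0.
near=> n.
have n0 : (0 < n)%N by near: n; exact: nbhs_infty_gt.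
have -> : c - (\sum_(i < n) g (X i w)) / n%:R =
    - ((\sum_(i < n) h (X i w)) / n%:R).
  rewrite /h sumrB sumr_const card_ord mulrBl -[c *+ n]mulr_natl mulrAC divff.
    by rewrite mul1r opprB.
  by rewrite pnatr_eq0 -lt0n.
by rewrite normrN; near: n; exact: hw.
Unshelve. all: by end_near. Qed.

End strong_law.

(** * Measures on the circle *)

Section borel_complex.
Context {R : realType}.

Lemma continuous_measurable_borelC (f : (R[i])^o -> R) :
  continuous f -> measurable_fun setT (f : borelC R -> R).
Proof.
move=> /continuousP cf; apply: (measurability _ (RGenOpens.measurableE R)).
move=> _ [_ [a [b ->] <-]]; rewrite setTI.
by apply: sub_sigma_algebra; apply: cf; exact: interval_open.
Qed.

Lemma modc_is_continuous : continuous (modc : (R[i])^o -> R).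
Proof.
apply: lipschitz_continuous => z w; rewrite ler_norml ler_modcB andbT.
by rewrite lerNl opprB modcBC ler_modcB.
Qed.

Definition circle : set (borelC R) := [set z : R[i] | `|z| = 1].

Lemma circleP (z : R[i]) : circle z <-> modc z = 1.
Proof. by rewrite /circle/= modcE; split => [[]//|->]. Qed.

Lemma measurable_circle : measurable circle.
Proof.
rewrite (_ : circle = modc @^-1` [set 1]).
  rewrite -[X in measurable X]setTI.
  exact: (continuous_measurable_borelC modc_is_continuous).
by apply/seteqP; split => z ?; exact/circleP.
Qed.

Lemma cst_continuousC (c : R) : continuous (fun _ : (R[i])^o => c).
Proof. exact: cst_continuous. Qed.

Lemma linear_comb_continuous (T : eqType) (s : seq T) (c : T -> R)
    (F : T -> (R[i])^o -> R) : (forall v, v \in s -> continuous (F v)) ->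
  continuous (fun z => \sum_(v <- s) c v * F v z).
Proof.
elim: s => [_|v s IH h].
  rewrite (_ : (fun z => _) = fun=> 0); first exact: cst_continuousC.
  by apply/funext => z; rewrite big_nil.
rewrite (_ : (fun z => _) = (fun z => c v * F v z) \+
    (fun z => \sum_(v <- s) c v * F v z)); last first.
  by apply/funext => z; rewrite big_cons.
have cs : continuous (fun z => \sum_(v <- s) c v * F v z).
  by apply: IH => u us; apply: h; rewrite inE us orbT.
have cv : continuous (F v) by apply: h; rewrite inE eqxx.
move=> z; exact: (cvgD (cvgM (@cst_continuousC (c v) z) (cv z)) (cs z)).
Qed.

(** A continuous f may be unbounded on the plane; extending its restriction by 0 gives the global
    bound that [slln] asks for. *)
Lemma bounded_on_circle (f : (R[i])^o -> R) : continuous f ->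
  exists M, forall z, `|(f \_ circle) z| <= M.
Proof.
move=> cf; have [C C0 hC] := modulus_of_continuity cf ltr01.
exists (`|f 0| + 1 + C) => z; rewrite patchE; case: ifPn => [|_]; last first.
  by rewrite normr0 !addr_ge0.
rewrite inE => /circleP z1.
have := hC z 0; rewrite z1 modc0 subr0 z1 expr1n mulr1 => h.
rewrite -[f z](subrK (f 0)) (le_trans (ler_normD _ _))// addrC -addrA lerD2l.
by apply: h; rewrite ?ler1n.
Qed.

(* A continuous function on the plane that agrees with [poisson w] on the
   circle; [poisson w] itself has a pole at [w]. *)
Definition poisson_ext (w : R[i]) (z : (R[i])^o) : R :=
  (modc w ^+ 2 - 1) / Num.max (modc (w - z) ^+ 2) ((modc w - 1) ^+ 2).

Lemma poisson_extE w z : 1 < modc w -> modc z = 1 ->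
  poisson_ext w z = poisson w z.
Proof.
move=> w1 z1; rewrite poissonE ?modc_ltP ?z1// expr1n /poisson_ext.
congr (_ / _); apply/max_idPl; rewrite lerXn2r ?nnegrE ?modc_ge0//.
  by rewrite subr_ge0 ltW.
by rewrite -z1 ler_modcB.
Qed.

Lemma inv_max_continuous (w : R[i]) (c : R) : 0 < c ->
  continuous (fun z : (R[i])^o => (Num.max (modc (w - z) ^+ 2) c)^-1).
Proof.
move=> c0 z; have d0 : Num.max (modc (w - z) ^+ 2) c != 0.
  by rewrite gt_eqF// lt_max c0 orbT.
have cw : continuous (fun z : (R[i])^o => modc (w - z)).
  apply: lipschitz_continuous => x y.
  have -> : modc (x - y) = modc ((w - x) - (w - y)).
    by rewrite modcBC; congr modc; ring.
  by rewrite ler_norml ler_modcB andbT lerNl opprB [leRHS]modcBC ler_modcB.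
have cw2 : {for z, continuous (fun z : (R[i])^o => modc (w - z) ^+ 2)}.
  exact: (continuous_comp (cw z) (@exprn_continuous R 2 _)).
have cm := continuous_max cw2 (@cst_continuousC c z).
exact: (cvgV d0 cm).
Qed.

Lemma poisson_ext_continuous w : 1 < modc w -> continuous (poisson_ext w).
Proof.
move=> w1 z; apply: (cvgM (@cst_continuousC _ z)).
by apply: inv_max_continuous; rewrite exprn_gt0// subr_gt0.
Qed.

End borel_complex.

Section circle_integral.
Context {R : realType}.
Variable mu : probability (borelC R) R.
Hypothesis mu1 : mu circle = 1%E.

(** Integrating over the circle only makes every continuous function integrable, bounded on the
    plane or not. *)
Definition circle_int (f : (R[i])^o -> R) : R := (\int[mu]_(z in circle) f z)%R.

Lemma integrable_circle (f : (R[i])^o -> R) : continuous f ->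
  mu.-integrable circle (EFin \o f).
Proof.
move=> cf; have [M hM] := bounded_on_circle cf.
apply: measurable_bounded_integrable.
- exact: measurable_circle.
- by rewrite [ltLHS]mu1 ltry.
- by apply: measurable_funTS; exact: continuous_measurable_borelC.
exists M; split; first by rewrite num_real.
move=> x Mx z zc /=; have := hM z; rewrite patchE mem_set// => /le_trans; apply.
exact: ltW.
Qed.

Lemma circle_int_sum (T : eqType) (s : seq T) (c : T -> R)
    (F : T -> (R[i])^o -> R) : (forall v, v \in s -> continuous (F v)) ->
  circle_int (fun z => \sum_(v <- s) c v * F v z) =
  \sum_(v <- s) c v * circle_int (F v).
Proof.
have mc := @measurable_circle R.
elim: s => [_|v s IH h].
  rewrite big_nil /circle_int; under eq_Rintegral do rewrite big_nil.
  by rewrite Rintegral_cst// mul0r.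
have cs : forall u, u \in s -> continuous (F u).
  by move=> u us; apply: h; rewrite inE us orbT.
have cv : continuous (F v) by apply: h; rewrite inE eqxx.
rewrite big_cons -IH// /circle_int -RintegralZl//; last exact: integrable_circle.
rewrite -RintegralD//.
- by apply: eq_Rintegral => z _; rewrite big_cons.
- apply: integrable_circle => z.
  exact: (cvgM (@cst_continuousC R (c v) z) (cv z)).
- exact/integrable_circle/linear_comb_continuous.
Qed.

Lemma circle_int_close (f g : (R[i])^o -> R) (e : R) :
  continuous f -> continuous g ->
  (forall z, modc z = 1 -> `|f z - g z| <= e) ->
  `|circle_int f - circle_int g| <= e.
Proof.
move=> cf cg h; have mc := @measurable_circle R.
have cfg : continuous (fun z => f z - g z).
  by move=> z; exact: (cvgB (cf z) (cg z)).
rewrite /circle_int -RintegralB//; try exact: integrable_circle.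
apply: (le_trans (le_normr_Rintegral mc (integrable_circle cfg))).
have -> : e = (\int[mu]_(z in circle) e)%R.
  by rewrite Rintegral_cst// [X in fine X]mu1 mulr1.
apply: le_Rintegral => //.
- exact: integrable_norm (integrable_circle cfg).
- by apply: (@integrable_circle (fun=> e)); exact: cst_continuousC.
by move=> z /circleP/h.
Qed.

Lemma integral_circle (f : (R[i])^o -> R) (M : R) : continuous f ->
  (forall z, `|f z| <= M) -> (\int[mu]_z (f z)%:E)%E = (circle_int f)%:E.
Proof.
move=> cf fM; have mc := @measurable_circle R.
have muC : mu (~` circle) = 0%E by rewrite probability_setC// mu1 subee.
rewrite /circle_int /Rintegral fineK; last first.
  exact: integrable_fin_num (integrable_circle cf).
rewrite (negligible_integral (N := ~` circle))//.
- by rewrite setDE setCK setTI.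
- exact: measurableC.
- exact: (bounded_integrable (probability_lty mu)
    (continuous_measurable_borelC cf) fM).
Qed.

End circle_integral.

(** * Integrals against the zero-counting measures *)

Section zeros_measure.
Context {R : realType}.
Variables (a : nat -> R[i]) (k n : nat).
Hypothesis kn : (k < n)%N.

Lemma ge0_integral_derivn_zeros (f : borelC R -> R) :
  measurable_fun setT f -> (forall z, 0 <= f z) ->
  (\int[derivn_zeros_measure a k n]_z (f z)%:E =
   (avg (zeros (sample_poly a n)^`(k)) f)%:E)%E.
Proof.
move=> mf f0; have mEf : measurable_fun setT (EFin \o f) by exact/measurable_EFinP.
have f0' z : [set: borelC R] z -> (0 <= (f z)%:E)%E by rewrite lee_fin.
rewrite /derivn_zeros_measure ge0_integral_mscale// ge0_integral_measure_sum//=.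
under eq_bigr do rewrite integral_dirac// diracT mul1e.
rewrite sumEFin -EFinM /avg size_zeros_derivn 1?ltnW// mulrC; congr (_ / _)%:E.
rewrite [RHS](big_nth 0) size_zeros_derivn 1?ltnW//.
by rewrite big_mkord.
Qed.

Lemma integral_derivn_zeros (f : (R[i])^o -> R) : continuous f ->
  (\int[derivn_zeros_measure a k n]_z (f z)%:E =
   (avg (zeros (sample_poly a n)^`(k)) f)%:E)%E.
Proof.
move=> cf; have mf := continuous_measurable_borelC cf.
rewrite integralE.
have -> : (fun z : borelC R => (f z)%:E)^\+%E =
    (fun z => (Num.max (f z) 0)%:E).
  by apply/funext => z; rewrite funeposE EFin_max.
have -> : (fun z : borelC R => (f z)%:E)^\-%E =
    (fun z => (Num.max (- f z) 0)%:E).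
  by apply/funext => z; rewrite funenegE EFin_max.
rewrite !ge0_integral_derivn_zeros.
- rewrite -EFinB -avgB; congr EFin; apply: eq_avg => z _ /=.
  have [f0|/ltW f0] := lerP 0 (f z).
    by rewrite (max_idPr _) ?subr0// oppr_le0.
  by rewrite (max_idPl _) ?oppr_ge0// sub0r opprK.
- by apply: measurable_maxr => //; exact: measurable_funN.
- by move=> z; rewrite le_max lexx orbT.
- exact: measurable_maxr.
- by move=> z; rewrite le_max lexx orbT.
Qed.

End zeros_measure.

Section empirical.
Context {R : realType}.
Variable mu : probability (borelC R) R.
Hypothesis mu1 : mu circle = 1%E.

(** Convergence is assumed only for countably many test functions, so that a single almost sure
    event can serve all continuous f. Combinations of these functions approximate f uniformly on the
    circle by [poisson_approx], whose defect term vanishes there. *)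
Lemma empirical_cvg (a : nat -> R[i]) (f : (R[i])^o -> R) :
  (forall i, modc (a i) = 1) -> continuous f ->
  (forall l M i, (i <= M)%N ->
    (fun n => avg (mkseq a n) (poisson_ext (nodes l M)`_i)) @ \oo -->
      circle_int mu (poisson_ext (nodes l M)`_i)) ->
  (fun n => avg (mkseq a n) f) @ \oo --> circle_int mu f.
Proof.
move=> a1 cf hp; apply/cvgrPdist_le => e e0.
have e30 : 0 < e / 3 by rewrite divr_gt0.
have [l [M [C C0 hf]]] := poisson_approx cf e30.
pose ns : seq R[i] := nodes l M; rewrite -/ns in hf.
have ns1 v : v \in ns -> 1 < modc v by move=> /modc_node ->; exact: radius_gt1.
pose c v := f v / (size ns)%:R.
pose g z := \sum_(v <- ns) c v * poisson_ext v z.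
have cP v : v \in ns -> continuous (poisson_ext v).
  by move=> /ns1; exact: poisson_ext_continuous.
have cg : continuous g by exact: linear_comb_continuous.
have fg z : modc z = 1 -> `|f z - g z| <= e / 3.
  move=> z1; have := hf z; rewrite z1 expr1n subrr mulr0 addr0.
  move=> /(_ (lexx _)); rewrite /g /avg mulr_suml.
  congr (`|_ - _| <= _); apply: eq_big_seq => v vn.
  by rewrite poisson_extE ?ns1// /c mulrAC.
have hg : (fun n => avg (mkseq a n) g - circle_int mu g) @ \oo --> 0.
  rewrite /g circle_int_sum//.
  have gE n : avg (mkseq a n) (fun z => \sum_(v <- ns) c v * poisson_ext v z) -
      \sum_(v <- ns) c v * circle_int mu (poisson_ext v) =
      \sum_(v <- ns) c v * (avg (mkseq a n) (poisson_ext v) -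
        circle_int mu (poisson_ext v)).
    rewrite avg_sum -sumrB; apply: eq_bigr => v _.
    by rewrite avgZ mulrBr.
  under eq_fun do rewrite gE.
  apply: cvg_sum0 => v vn; apply: cvgZ0.
  have iM : (index v ns <= M)%N.
    by rewrite -ltnS -(@size_nodes R l M) index_mem.
  have := hp l M _ iM; rewrite nth_index// => h.
  rewrite -[X in _ --> X](subrr (circle_int mu (poisson_ext v))).
  by apply: cvgB => //; exact: cvg_cst.
have /cvgr0Pnorm_le/(_ _ e30) hg' := hg.
near=> n.
have n0 : (0 < n)%N by near: n; exact: nbhs_infty_gt.
have h1 : `|avg (mkseq a n) g - circle_int mu g| <= e / 3.
  by near: n; exact: hg'.
have h2 := circle_int_close mu1 cf cg fg.
have h3 : `|avg (mkseq a n) f - avg (mkseq a n) g| <= e / 3.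
  rewrite -avgB (le_trans (ler_norm_avg _ _))//.
  rewrite -[leRHS](@avg_cst _ (mkseq a n)) ?size_mkseq//.
  by apply: le_avg => z /mapP[i _ ->]; exact: fg.
move: h1 h2 h3; rewrite !ler_norml => /andP[? ?] /andP[? ?] /andP[? ?].
by apply/andP; split; lra.
Unshelve. all: by end_near. Qed.

Context d (T : measurableType d) (P : probability T R).
Variable Z : nat -> {RV P >-> borelC R}.
Hypothesis iidZ : iid_with_law P Z mu.

Lemma ae_on_circle : {ae P, forall w, forall i, modc (Z i w) = 1}.
Proof.
have mc := @measurable_circle R.
apply: ae_foralln => i; exists (Z i @^-1` ~` circle); split.
- rewrite -[X in measurable X]setTI; apply: measurable_funPT => //.
  exact: measurableC.
- apply: etrans (iid_law iidZ i (measurableC mc)) _.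
  by rewrite probability_setC// mu1 subee.
- by move=> w /= h zc; apply: h; exact/circleP.
Qed.

Lemma slln_circle (f : (R[i])^o -> R) : continuous f ->
  {ae P, forall w, (fun n => avg (mkseq (fun i => Z i w) n) f) @ \oo -->
    circle_int mu f}.
Proof.
move=> cf; have [M hM] := bounded_on_circle cf.
have mc := @measurable_circle R.
have mf : measurable_fun setT (f \_ circle).
  apply/(measurable_restrictT _ _).1 => //.
  by apply: measurable_funTS; exact: continuous_measurable_borelC.
have := slln iidZ mf hM.
apply: filterS2 ae_on_circle => w w1.
rewrite -Rintegral_mkcond -/(circle_int mu f) => h.
rewrite (_ : (fun n => avg _ f) =
  fun n => (\sum_(i < n) (f \_ circle) (Z i w)) / n%:R)//.
apply/funext => n; rewrite avg_mkseq; congr (_ / _); apply: eq_bigr => i _.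
by rewrite patchE mem_set//; apply/circleP.
Qed.

End empirical.

(** * Vanishing moments: small arcs have small measure *)

Section circle_moments.
Context {R : realType}.
Variable mu : probability (borelC R) R.
Hypothesis mu1 : mu circle = 1%E.

Lemma ReXn_ImXn_continuous m :
  continuous (fun z : (R[i])^o => Re ((z : R[i]) ^+ m)) /\
  continuous (fun z : (R[i])^o => Im ((z : R[i]) ^+ m)).
Proof.
elim: m => [|m [cR cI]]; first by split; exact: cst_continuousC.
have E (z : R[i]) : Re (z ^+ m.+1) = Re z * Re (z ^+ m) - Im z * Im (z ^+ m) /\
    Im (z ^+ m.+1) = Re z * Im (z ^+ m) + Im z * Re (z ^+ m).
  by rewrite exprS; case: z (z ^+ m) => ? ? [].
split.
  rewrite (_ : (fun z => _) = (fun z : (R[i])^o =>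
      Re (z : R[i]) * Re ((z : R[i]) ^+ m) - Im (z : R[i]) * Im ((z : R[i]) ^+ m))).
    move=> z; exact: (cvgB (cvgM (@Re_continuous R z) (cR z))
                           (cvgM (@Im_continuous R z) (cI z))).
  by apply/funext => z; exact: (E z).1.
rewrite (_ : (fun z => _) = (fun z : (R[i])^o =>
    Re (z : R[i]) * Im ((z : R[i]) ^+ m) + Im (z : R[i]) * Re ((z : R[i]) ^+ m))).
  move=> z; exact: (cvgD (cvgM (@Re_continuous R z) (cI z))
                         (cvgM (@Im_continuous R z) (cR z))).
by apply/funext => z; exact: (E z).2.
Qed.

Lemma circle_int_cst (c : R) : circle_int mu (fun=> c) = c.
Proof.
have mc := @measurable_circle R.
by rewrite /circle_int Rintegral_cst// [X in fine X]mu1 mulr1.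
Qed.

Lemma circle_intD (f g : (R[i])^o -> R) : continuous f -> continuous g ->
  circle_int mu (fun z => f z + g z) = circle_int mu f + circle_int mu g.
Proof.
move=> cf cg; have mc := @measurable_circle R.
by rewrite /circle_int RintegralD//; exact: integrable_circle.
Qed.

Lemma circle_intZ (c : R) (f : (R[i])^o -> R) : continuous f ->
  circle_int mu (fun z => c * f z) = c * circle_int mu f.
Proof.
move=> cf; have mc := @measurable_circle R.
by rewrite /circle_int RintegralZl//; exact: integrable_circle.
Qed.

Hypothesis moments0 : forall m,
  circle_int mu (fun z => Re ((z : R[i]) ^+ m.+1)) = 0 /\
  circle_int mu (fun z => Im ((z : R[i]) ^+ m.+1)) = 0.

Lemma ReM_Im (z w : R[i]) : Re (z * w) = Re z * Re w - Im z * Im w.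
Proof. by case: z; case: w. Qed.

Let geom (v : R[i]) N (u : R[i]) := \sum_(j < N) (v * u) ^+ j.

Lemma geomS v N u : geom v N.+1 u = 1 + v * u * geom v N u.
Proof.
rewrite /geom big_ord_recl expr0 mulr_sumr; congr (_ + _).
by apply: eq_bigr => j _; rewrite /= exprS.
Qed.

Lemma Re_geom v N u : Re (v * u * geom v N u) =
  \sum_(j <- iota 0 N) (Re (v ^+ j.+1) * Re (u ^+ j.+1) +
                        - Im (v ^+ j.+1) * Im (u ^+ j.+1)).
Proof.
rewrite mulr_sumr Re_sum -[in RHS](subn0 N) -/(index_iota 0 N) big_mkord.
by apply: eq_bigr => j _; rewrite -exprS exprMn ReM_Im mulNr.
Qed.

Let Re_geom_continuous v N :
  continuous (fun u : (R[i])^o => Re (v * u * geom v N u)).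
Proof.
rewrite (_ : (fun u => _) = (fun u : (R[i])^o =>
  (\sum_(j <- iota 0 N) Re (v ^+ j.+1) * Re ((u : R[i]) ^+ j.+1)) +
  (\sum_(j <- iota 0 N) - Im (v ^+ j.+1) * Im ((u : R[i]) ^+ j.+1)))).
  move=> u; apply: (@cvgD _ _ _ (nbhs u)).
    by apply: linear_comb_continuous => j _; exact: (ReXn_ImXn_continuous _).1.
  by apply: linear_comb_continuous => j _; exact: (ReXn_ImXn_continuous _).2.
by apply/funext => u; rewrite Re_geom big_split.
Qed.

Let circle_int_Re_geom v N :
  circle_int mu (fun u => Re (v * (u : R[i]) * geom v N u)) = 0.
Proof.
rewrite (_ : (fun u => _) = (fun u : (R[i])^o =>
  (\sum_(j <- iota 0 N) Re (v ^+ j.+1) * Re ((u : R[i]) ^+ j.+1)) +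
  (\sum_(j <- iota 0 N) - Im (v ^+ j.+1) * Im ((u : R[i]) ^+ j.+1)))).
  rewrite circle_intD; last 2 first.
  - by apply: linear_comb_continuous => j _; exact: (ReXn_ImXn_continuous _).1.
  - by apply: linear_comb_continuous => j _; exact: (ReXn_ImXn_continuous _).2.
  rewrite (circle_int_sum mu1); last first.
    by move=> j _; exact: (ReXn_ImXn_continuous _).1.
  rewrite (circle_int_sum mu1); last first.
    by move=> j _; exact: (ReXn_ImXn_continuous _).2.
  rewrite !big1 ?addr0// => j _; first by rewrite (moments0 j).2 mulr0.
  by rewrite (moments0 j).1 mulr0.
by apply/funext => u; rewrite Re_geom big_split.
Qed.

(* Replaces |geom v N|^2 by a function that is visibly continuous and equal
   to it on the circle. *)
Fixpoint geom_sq v N (u : (R[i])^o) : R :=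
  if N is N'.+1 then 1 + geom_sq v N' u + 2 * Re (v * (u : R[i]) * geom v N' u)
  else 0.

Lemma geom_sqE v N u : modc v = 1 -> modc u = 1 ->
  geom_sq v N u = modc (geom v N u) ^+ 2.
Proof.
move=> v1 u1; elim: N => [|N IH] /=.
  by rewrite /geom big_ord0 modc0 expr0n.
rewrite IH geomS.
(* Multiplying by v u, of modulus 1, gives x = v u [geom v N u], and then |1 + x|^2 = 1 + |x|^2 + 2
   Re x. *)
have -> : modc (geom v N u) = modc (v * u * geom v N u).
  by rewrite !modcM v1 u1 !mul1r.
by rewrite !modc_sq; case: (_ * _) => x y /=; ring.
Qed.

Lemma geom_sq_continuous v N : continuous (geom_sq v N).
Proof.
elim: N => [|N IH]; first exact: cst_continuousC.
move=> u; exact: (cvgD (cvgD (@cst_continuousC R 1 u) (IH u))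
  (cvgM (@cst_continuousC R 2 u) (@Re_geom_continuous v N u))).
Qed.

(** Parseval for vanishing moments: the cross term of each step integrates to 0, so every step of
    the recursion adds exactly 1. *)
Lemma circle_int_geom_sq v N : circle_int mu (geom_sq v N) = N%:R.
Proof.
elim: N => [|N IH]; first exact: circle_int_cst.
rewrite /geom_sq -/(geom_sq v N) circle_intD.
- rewrite circle_intD ?circle_int_cst ?IH; last 2 first.
  + exact: cst_continuousC.
  + exact: geom_sq_continuous.
  rewrite circle_intZ ?circle_int_Re_geom ?mulr0 ?addr0; last first.
    exact: Re_geom_continuous.
  by rewrite addrC natr1.
- move=> u; exact: (cvgD (@cst_continuousC R 1 u) (@geom_sq_continuous v N u)).
- move=> u; exact: (cvgM (@cst_continuousC R 2 u) (@Re_geom_continuous v N u)).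
Qed.

Lemma modc_expB1 (z : R[i]) j : modc z = 1 -> modc (z ^+ j - 1) <= j%:R * modc (z - 1).
Proof.
move=> z1; elim: j => [|j IH]; first by rewrite subrr modc0 mul0r.
have -> : z ^+ j.+1 - 1 = z * (z ^+ j - 1) + (z - 1) by rewrite exprS; ring.
rewrite (le_trans (ler_modcD _ _))// modcM z1 mul1r -natr1 mulrDl mul1r.
by rewrite lerD2r.
Qed.

(** With z = conj v u, the power z^j is within j / N of 1, and these errors sum to at most N / 2. *)
Lemma geom_ge v N u : (0 < N)%N -> modc v = 1 -> modc u = 1 ->
  modc (u - v) <= N%:R^-1 -> N%:R / 2 <= modc (geom (conjc v) N u).
Proof.
move=> N0 v1 u1 uv; pose z := conjc v * u.
have z1 : modc z = 1 by rewrite modcM modc_conj v1 u1 mulr1.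
have zB : modc (z - 1) <= N%:R^-1.
  have v0 : v != 0 by rewrite -modc_eq0 v1 oner_eq0.
  have -> : z - 1 = conjc v * (u - v).
    by rewrite /z (conjc_unit v1) mulrBr mulVf.
  by rewrite modcM modc_conj v1 mul1r.
have h : modc (N%:R - geom (conjc v) N u) <= N%:R / 2.
  have -> : N%:R - geom (conjc v) N u = \sum_(j < N) (1 - z ^+ j).
    by rewrite sumrB sumr_const card_ord.
  apply: (le_trans (ler_modc_sum _ _ _)).
  apply: (@le_trans _ _ (\sum_(j < N) j%:R * N%:R^-1)).
    apply: ler_sum => j _; rewrite modcBC (le_trans (modc_expB1 _ z1))//.
    by rewrite ler_wpM2l.
  rewrite -mulr_suml ler_pdivrMr ?ltr0n// -natr_sum.
  rewrite mulrAC ler_pdivlMr// -natrM -natrM ler_nat.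
  elim: {N0 uv zB} N => [|N IH]; first by rewrite big_ord0.
  rewrite big_ord_recr/= mulnDl (leq_trans (leq_add IH (leqnn _)))//.
  by rewrite mulSn [(N * N.+1)%N]mulnS muln2 -addnn addnC -addnA leq_add2r.
have := ler_modcB N%:R (N%:R - geom (conjc v) N u).
rewrite modc_nat opprB addrCA subrr addr0.
by move: h; lra.
Qed.

(** Chebyshev's inequality: centred at a point of [D] on the circle, the squared geometric sum is at
    least N^2 / 4 on the part of [D] in the circle, while its integral is N. *)
Lemma small_diameter (D : set (borelC R)) N : (0 < N)%N -> measurable D ->
  (forall u v : R[i], D u -> D v -> modc u = 1 -> modc v = 1 ->
    modc (u - v) <= N%:R^-1) ->
  (mu D <= (4 / N%:R)%:E)%E.
Proof.
move=> N0 mD hD; have mc := @measurable_circle R.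
have muC : mu (~` circle) = 0%E by rewrite probability_setC// mu1 subee.
have mDc : measurable (D `&` circle) by exact: measurableI.
have -> : mu D = mu (D `&` circle).
  rewrite -[in LHS](setIT D) -(setUv circle) setIUr measureU//.
  - rewrite [X in (_ + X)%E](_ : _ = 0%E) ?adde0//.
    apply: (subset_measure0 _ _ _ muC) => //.
    + by apply: measurableI => //; exact: measurableC.
    + exact: measurableC.
  - by apply: measurableI => //; exact: measurableC.
  - by rewrite setIACA setICr setI0.
have [->|/set0P[v [Dv /circleP v1]]] := eqVneq (D `&` circle) set0.
  by rewrite measure0 lee_fin divr_ge0.
have NR : 0 < N%:R :> R by rewrite ltr0n.
have cv1 : modc (conjc v) = 1 by rewrite modc_conj.
have cg := @geom_sq_continuous (conjc v) N.
have mg : measurable_fun setT (fun z : borelC R => (geom_sq (conjc v) N z)%:E).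
  by apply/measurable_EFinP; exact: continuous_measurable_borelC.
have g0 (z : borelC R) : circle z -> (0 <= (geom_sq (conjc v) N z)%:E)%E.
  by move=> /circleP z1; rewrite lee_fin geom_sqE// sqr_ge0.
have hN : (((N%:R / 2) ^+ 2)%:E * mu (D `&` circle) <= N%:R%:E)%E.
  rewrite -integral_cst//.
  apply: (@le_trans _ _ (\int[mu]_(z in D `&` circle)
    (geom_sq (conjc v) N z)%:E)%E).
    apply: ge0_le_integral => //.
    - by move=> z _; rewrite lee_fin sqr_ge0.
    - exact: measurable_funTS.
    - move=> z [Dz /circleP z1]; rewrite lee_fin geom_sqE// ler_sqr ?nnegrE ?modc_ge0//.
      by apply: geom_ge => //; exact: hD.
  apply: (@le_trans _ _ (\int[mu]_(z in circle) (geom_sq (conjc v) N z)%:E)%E).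
    apply: ge0_subset_integral => //; exact: measurable_funTS.
  rewrite -(circle_int_geom_sq (conjc v) N) /circle_int /Rintegral fineK//.
  exact: integrable_fin_num (integrable_circle mu1 cg).
have fm : mu (D `&` circle) \is a fin_num by exact: fin_num_measure.
move: hN; rewrite -(fineK fm) -EFinM !lee_fin => hN.
rewrite ler_pdivlMr//.
have := hN; rewrite expr_div_n; move: (fine _) => x.
have -> : N%:R ^+ 2 / 2 ^+ 2 * x = N%:R * (N%:R * x / 4) by field.
by rewrite -[leRHS]mulr1 ler_pM2l// => ?; lra.
Qed.

End circle_moments.

(** * Vanishing moments: anticoncentration of the ratio *)

Section cylinders.
Context d d' (T : measurableType d) (T' : measurableType d') (R : realType).
Variables (P : probability T R) (X : nat -> {RV P >-> T'}).
Variable mu : probability T' R.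
Hypothesis iidX : iid_with_law P X mu.

(* The cylinders generate the sigma-algebra of the first [n] samples. *)
Definition cylinder n : set (set T) :=
  [set B | exists2 A : nat -> set T', forall i, measurable (A i) &
    B = \bigcap_(i in [set` iota 0 n]) (X i @^-1` A i)].

(** The carrier is still [T] and only the sigma-algebra shrinks, so [to_past] is the identity. *)
Definition past n := g_sigma_algebraType (cylinder n).

Lemma cylinderT n : cylinder n setT.
Proof.
by exists (fun=> setT) => //; apply/seteqP; split.
Qed.

Lemma cylinderI n : setI_closed (cylinder n).
Proof.
move=> _ _ [A mA ->] [B mB ->]; exists (fun i => A i `&` B i).
  by move=> i; exact: measurableI.
by rewrite -bigcapI.
Qed.

Lemma cylinder_measurable n : cylinder n `<=` measurable.
Proof.
move=> _ [A mA ->]; apply: fin_bigcap_measurable => // i _.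
by rewrite -[X in measurable X]setTI; exact: measurable_funPT.
Qed.

Lemma past_measurable n (E : set T) :
  measurable (E : set (past n)) -> measurable E.
Proof.
move=> mE; apply: (smallest_sub (@sigma_algebra_measurable _ T)) mE.
exact: cylinder_measurable.
Qed.

Definition to_past n : T -> past n := id.

Lemma measurable_to_past n : measurable_fun setT (@to_past n).
Proof. by move=> _ E mE; rewrite setTI; exact: past_measurable mE. Qed.

Lemma measurable_past_sample n i : (i < n)%N ->
  measurable_fun setT (X i : past n -> T').
Proof.
move=> iltn _ B mB; rewrite setTI; apply: sub_sigma_algebra.
exists (fun j => if j == i then B else setT) => [j|]; first by case: ifP.
apply/seteqP; split => [w Bw j _ /=|w]; first by case: ifP => // /eqP ->.
by move=> /(_ i); rewrite /= mem_iota/= eqxx; apply.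
Qed.

HB.instance Definition _ n :=
  isMeasurableFun.Build _ _ T (past n) (@to_past n) (@measurable_to_past n).

(** For fixed [B] both sides are finite measures in [E]. They agree on the cylinders, which are
    closed under intersection and generate the sigma-algebra. *)
Lemma past_independent n (E : set (past n)) (B : set T') :
  measurable E -> measurable B ->
  P (E `&` X n @^-1` B) = (P E * mu B)%E.
Proof.
move=> mE mB.
have mXB : measurable (X n @^-1` B).
  by rewrite -[X in measurable X]setTI; exact: measurable_funPT.
have b0 : 0 <= fine (mu B) by exact: fine_ge0.
pose m1 := mrestr P mXB.
pose m2 := mscale (NngNum b0) P.
have : m1 E = m2 E.
  apply: (g_sigma_algebra_measure_unique (cylinder n) _ (fun=> setT)) => //.
  - exact: cylinder_measurable.
  - by move=> _; exact: cylinderT.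
  - by rewrite bigcup_const.
  - exact: cylinderI.
  - move=> _ [A mA ->].
    pose F i := if (i < n)%N then A i else B.
    have mF i : measurable (F i) by rewrite /F; case: ifP.
    have Fn : F n = B by rewrite /F ltnn.
    have FA i : i \in iota 0 n -> F i = A i.
      by rewrite mem_iota/= add0n /F => ->.
    have e1 := iidX.1 _ _ (iota_uniq 0 n) mA.
    have := iidX.1 _ _ (iota_uniq 0 n.+1) mF.
    rewrite -[in iota _ _]addn1 iotaD/= add0n big_cat/= big_seq1 Fn.
    rewrite [P (X n @^-1` B)](iid_law iidX n mB).
    rewrite (eq_big_seq (fun i => P (X i @^-1` A i))); last first.
      by move=> i /FA ->.
    rewrite -e1 => e2.
    rewrite /m1 /m2 /mrestr /mscale/= fineK; last first.
      exact: fin_num_measure.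
    rewrite muleC -e2; congr (P _).
    apply/seteqP; split => [w [wA wB] i /=|w wF].
      rewrite mem_cat inE => /orP[iN|/eqP ->]; last by rewrite Fn.
      by rewrite FA//; exact: wA.
    split=> [i /= iN|].
      by have := wF i; rewrite /= mem_cat iN/= FA//; apply.
    by have := wF n; rewrite /= mem_cat inE eqxx orbT Fn; apply.
  - by move=> _; rewrite /m1/= /mrestr setTI (le_lt_trans (probability_le1 _ mXB))// ltry.
rewrite /m1 /m2 /mrestr /mscale/= => ->; rewrite muleC fineK//.
exact: fin_num_measure.
Qed.

End cylinders.

Section joint_law.
Context d d' (T : measurableType d) (T' : measurableType d') (R : realType).
Variables (P : probability T R) (X : nat -> {RV P >-> T'}).
Variable mu : probability T' R.
Hypothesis iidX : iid_with_law P X mu.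

(** The past and the next sample have a product law, so a bound valid for every section integrates
    to the same bound. *)
Lemma conditional_bound n (S : set (past X n * T')) (q : R) :
  measurable S -> (forall w, (mu (xsection S w) <= q%:E)%E) ->
  (P [set w | S (w, X n w)] <= q%:E)%E.
Proof.
move=> mS hS.
pose P' := distribution P (@to_past _ _ _ _ _ _ X n).
have ind (A : set (past X n)) (B : set T') : measurable A -> measurable B ->
    P ((@to_past _ _ _ _ _ _ X n @^-1` A) `&` (X n @^-1` B)) = (P' A * mu B)%E.
  by move=> mA mB; exact: past_independent.
have := law_pair_fun ind mS.
rewrite /pair_fun => E.
have -> : P [set w | S (w, X n w)] = (P' \x mu)%E S by rewrite -E.
have : (\int[P']_w (mu (xsection S w)) <= \int[P']_w q%:E)%E.
  apply: ge0_le_integral => //; exact: measurable_fun_xsection.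
by rewrite integral_cst_probability.
Qed.

End joint_law.

Section complex_measurability.
Context d (T : measurableType d) (R : realType).
Implicit Types f g : T -> R[i].

Definition measurable_complex f :=
  measurable_fun setT (fun t => Re (f t)) /\
  measurable_fun setT (fun t => Im (f t)).

Lemma measurable_complex_cst (c : R[i]) : measurable_complex (fun=> c).
Proof. by split; exact: measurable_cst. Qed.

Lemma measurable_complexD f g : measurable_complex f -> measurable_complex g ->
  measurable_complex (fun t => f t + g t).
Proof.
move=> [fR fI] [gR gI]; split.
  rewrite (_ : (fun t => _) = (fun t => Re (f t)) \+ (fun t => Re (g t))).
    exact: measurable_funD.
  by apply/funext => t; rewrite ReD.
rewrite (_ : (fun t => _) = (fun t => Im (f t)) \+ (fun t => Im (g t))).
  exact: measurable_funD.
by apply/funext => t /=; case: (f t) (g t) => ? ? [].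
Qed.

Lemma measurable_complexM f g : measurable_complex f -> measurable_complex g ->
  measurable_complex (fun t => f t * g t).
Proof.
move=> [fR fI] [gR gI]; split.
  rewrite (_ : (fun t => _) = (((fun t => Re (f t)) \* (fun t => Re (g t))) \-
      ((fun t => Im (f t)) \* (fun t => Im (g t))))%R).
    by apply: measurable_funB; exact: measurable_funM.
  by apply/funext => t; rewrite ReM_Im.
rewrite (_ : (fun t => _) = (((fun t => Re (f t)) \* (fun t => Im (g t))) \+
    ((fun t => Im (f t)) \* (fun t => Re (g t))))%R).
  by apply: measurable_funD; exact: measurable_funM.
by apply/funext => t /=; case: (f t) (g t) => ? ? [].
Qed.

Lemma measurable_modc f : measurable_complex f ->
  measurable_fun setT (fun t => modc (f t)).
Proof.
move=> [fR fI].
rewrite (_ : (fun t => _) = Num.sqrt \o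
    ((fun t => Re (f t) ^+ 2) \+ (fun t => Im (f t) ^+ 2))).
  apply: measurableT_comp; last first.
    by apply: measurable_funD; exact: measurable_funX.
  by apply: continuous_measurable_fun; exact: sqrt_continuous.
by apply/funext => t /=; rewrite -modc_sq sqrtr_sqr ger0_norm ?modc_ge0.
Qed.

Lemma measurable_modc_lt f (x : R) : measurable_complex f ->
  measurable [set t | modc (f t) < x].
Proof.
move=> mf.
rewrite (_ : [set _ | _] = (fun t => modc (f t)) @^-1` `]-oo, x[%classic).
  by rewrite -[X in measurable X]setTI; apply: measurable_modc.
by apply/seteqP; split => t /=; rewrite in_itv.
Qed.

End complex_measurability.

Lemma measurable_complex_comp d d' (T : measurableType d)
    (T' : measurableType d') (R : realType) (f : T' -> R[i]) (h : T -> T') :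
  measurable_complex f -> measurable_fun setT h ->
  measurable_complex (fun t => f (h t)).
Proof.
move=> [fR fI] mh; split.
  exact: (measurableT_comp fR mh).
exact: (measurableT_comp fI mh).
Qed.

Section ratio_recursion.
Context {R : realType}.
Implicit Types (w u v : R[i]).

(** The recursion [deriv_ratioSS] with arbitrary [b] in place of the 1 / (w - a i). With
    [inv_sub_ext] for [b] it is measurable on the whole sample space, including where samples leave
    the circle. *)
Fixpoint ratio_rec (b : nat -> R[i]) n k {struct n} : R[i] :=
  match n, k with
  | _, 0 => 1
  | 0, _.+1 => 0
  | n'.+1, k'.+1 => ratio_rec b n' k + k%:R * b n' * ratio_rec b n' k'
  end.

Lemma ratio_rec0 b n : ratio_rec b n 0 = 1.
Proof. by case: n. Qed.

Lemma deriv_ratioE (a : nat -> R[i]) w k n :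
  (forall i, modc (a i) = 1) -> modc w < 1 ->
  deriv_ratio a w k n = ratio_rec (fun i => (w - a i)^-1) n k.
Proof.
move=> a1 w1; elim: n k => [|n IH] [|k].
- by rewrite deriv_ratio0.
- by rewrite deriv_ratioS0.
- by rewrite deriv_ratio0.
- by rewrite deriv_ratioSS// !IH.
Qed.

(* A continuous function on the plane that agrees with [u |-> (w - u)^-1] on
   the circle. *)
Definition inv_sub_ext w u : R[i] :=
  conjc (w - u) *
  ((Num.max (modc (w - u) ^+ 2) ((1 - modc w) ^+ 2))^-1)%:C.

Lemma inv_sub_extE w u : modc w < 1 -> modc u = 1 ->
  inv_sub_ext w u = (w - u)^-1.
Proof.
move=> w1 u1; rewrite /inv_sub_ext invc_norm modcE mulrC; congr (_ * _).
rewrite (max_idPl _); first by rewrite fmorphV rmorphXn.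
rewrite lerXn2r ?nnegrE ?modc_ge0 ?subr_ge0 ?(ltW w1)//.
by rewrite modcBC -u1 ler_modcB.
Qed.

Lemma measurable_inv_sub_ext w : modc w < 1 ->
  measurable_complex (inv_sub_ext w : borelC R -> R[i]).
Proof.
move=> w1; apply: measurable_complexM; split.
- apply: (@continuous_measurable_borelC _ (fun u => Re (conjc (w - u)))).
  apply: lipschitz_continuous => x y; rewrite -ReB -conjcB.
  rewrite (le_trans (normr_Re_le _))// modc_conj modcBC.
  by rewrite (_ : w - y - (w - x) = x - y)//; ring.
- apply: (@continuous_measurable_borelC _ (fun u => Im (conjc (w - u)))).
  apply: lipschitz_continuous => x y.
  rewrite (_ : _ - _ = Im (conjc (w - x) - conjc (w - y))); last first.
    by case: (conjc (w - x)) (conjc (w - y)) => ? ? [].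
  rewrite -conjcB (le_trans (normr_Im_le _))// modc_conj modcBC.
  by rewrite (_ : w - y - (w - x) = x - y)//; ring.
- apply: (@continuous_measurable_borelC _ (fun u =>
    (Num.max (modc (w - u) ^+ 2) ((1 - modc w) ^+ 2))^-1)).
  by apply: inv_max_continuous; rewrite exprn_gt0// subr_gt0.
- exact: measurable_cst.
Qed.

Lemma measurable_ratio_rec d (T : measurableType d) (b : nat -> T -> R[i]) n k :
  (forall i, (i < n)%N -> measurable_complex (b i)) ->
  measurable_complex (fun t => ratio_rec (b ^~ t) n k).
Proof.
elim: n k => [|n IH] [|k] mb /=; try exact: measurable_complex_cst.
have mb' i : (i < n)%N -> measurable_complex (b i).
  by move=> iltn; apply: mb; rewrite ltnS ltnW.
apply: measurable_complexD; first exact: IH.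
apply: measurable_complexM; last exact: IH.
by apply: measurable_complexM; [exact: measurable_complex_cst|exact: mb].
Qed.

End ratio_recursion.

Section small_ratio.
Context {R : realType}.
Variable mu : probability (borelC R) R.
Hypothesis mu1 : mu circle = 1%E.
Hypothesis moments0 : forall m,
  circle_int mu (fun z => Re ((z : R[i]) ^+ m.+1)) = 0 /\
  circle_int mu (fun z => Im ((z : R[i]) ^+ m.+1)) = 0.
Context d (T : measurableType d) (P : probability T R).
Variable Z : nat -> {RV P >-> borelC R}.
Hypothesis iidZ : iid_with_law P Z mu.
Variable w : R[i].
Hypothesis w1 : modc w < 1.
Variable N : nat.
Hypothesis N0 : (0 < N)%N.

(** If x = 1 / (w - u) and y = 1 / (w - v) satisfy |x - y| <= 2 delta, then |u - v| = |x - y| |w -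
    u| |w - v| <= 8 delta = 1 / N. *)
Let delta : R := (8 * N%:R)^-1.
Let rec t n k := ratio_rec (fun i => inv_sub_ext w (Z i t)) n k.

Let delta0 : 0 < delta.
Proof. by rewrite invr_gt0 mulr_gt0// ltr0n. Qed.

(* Given the first n samples, the ratio of order k + 1 for n + 1 samples is an
   affine function of 1 / (w - Z_n) with slope (k + 1) times the ratio of order
   k, so it can be small only if Z_n lies in a short arc. *)
Lemma affine_small_diameter (A B u v : R[i]) (c : R) k :
  1 <= c -> delta ^+ k <= modc B -> modc u = 1 -> modc v = 1 ->
  modc (A + c%:C * inv_sub_ext w u * B) < delta ^+ k.+1 ->
  modc (A + c%:C * inv_sub_ext w v * B) < delta ^+ k.+1 ->
  modc (u - v) <= N%:R^-1.
Proof.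
move=> c1 hB u1 v1; rewrite !inv_sub_extE//.
set x := (w - u)^-1; set y := (w - v)^-1 => hx hy.
have wu z : modc z = 1 -> w - z != 0.
  by move=> z1; rewrite subr_eq0; apply: contraTneq w1 => ->; rewrite z1 ltxx.
have dk : 0 < delta ^+ k by rewrite exprn_gt0.
have h : modc (c%:C * (x - y) * B) <= 2 * delta ^+ k.+1.
  have -> : c%:C * (x - y) * B = (A + c%:C * x * B) - (A + c%:C * y * B) by ring.
  rewrite (le_trans (ler_modcD _ _))// modcN mulrDl mul1r.
  by rewrite lerD// ltW.
have c0 : 0 <= c by rewrite (le_trans _ c1).
have xy : modc (x - y) <= 2 * delta.
  rewrite -(ler_pM2r dk) -mulrA -exprS (le_trans _ h)//.
  rewrite !modcM modc_real ger0_norm// -mulrA (le_trans (ler_wpM2l _ hB)) ?modc_ge0//.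
  by rewrite ler_peMl// mulr_ge0 ?modc_ge0.
have -> : u - v = (x - y) * ((w - u) * (w - v)).
  by rewrite /x /y; field; rewrite !wu.
have w2 z : modc z = 1 -> modc (w - z) <= 2.
  move=> z1; rewrite (le_trans (ler_modcD _ _))// modcN z1.
  by rewrite -[2]/(1 + 1) lerD2r ltW.
rewrite modcM modcM.
have := ler_pM (modc_ge0 _) (modc_ge0 _) (w2 u u1) (w2 v v1).
move=> /(ler_pM (modc_ge0 _) (mulr_ge0 (modc_ge0 _) (modc_ge0 _)) xy).
move=> /le_trans; apply; rewrite /delta le_eqVlt; apply/orP; left; apply/eqP.
by field; rewrite pnatr_eq0 -lt0n.
Qed.

Lemma measurable_rec d' (T' : measurableType d') (f : T' -> T) n k :
  (forall i, (i < n)%N -> measurable_fun setT (Z i \o f)) ->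
  measurable_complex (fun t => rec (f t) n k).
Proof.
move=> mf; apply: measurable_ratio_rec => i iltn.
apply: (measurable_complex_comp (measurable_inv_sub_ext w1)); exact: mf.
Qed.

(** By induction on k, each order costs 4 / N: either the ratio of order k for n samples is already
    small, or the next sample falls into a short arc chosen by the past. The condition k <= n
    matters, since with fewer than k samples the ratio is 0. *)
Lemma probability_small_ratio k n : (k <= n)%N ->
  (P [set t | (modc (rec t n k) < delta ^+ k)%R] <= (k%:R * (4 / N%:R))%:E)%E.
Proof.
have mE k' n' : measurable [set t | modc (rec t n' k') < delta ^+ k'].
  by apply: measurable_modc_lt; apply: (@measurable_rec _ _ id).
have E0 n' : [set t | modc (rec t n' 0) < delta ^+ 0] = set0.
  apply/seteqP; split => t //.
  by rewrite /mkset /rec ratio_rec0 modc1 expr0 ltxx.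
elim: k n => [|k IH] [|n] kn //; first by rewrite E0 measure0 mul0r.
  by rewrite E0 measure0 mul0r.
pose G (tu : past Z n * borelC R) :=
  rec tu.1 n k.+1 + k.+1%:R * inv_sub_ext w tu.2 * rec tu.1 n k.
(* Pasts with a small slope are removed, so every section of [S] meets the circle in a set of
   diameter at most 1 / N. *)
pose S : set (past Z n * borelC R) := [set tu | modc (G tu) < delta ^+ k.+1] `\`
  [set tu | modc (rec tu.1 n k) < delta ^+ k].
have mrec k' : measurable_complex (fun tu : past Z n * borelC R => rec tu.1 n k').
  apply: (@measurable_complex_comp _ _ _ (past Z n) _ (fun t => rec t n k') fst).
    apply: (@measurable_rec _ (past Z n) id) => i iltn.
    exact: measurable_past_sample.
  exact: measurable_fst.
have mS : measurable S.
  apply: measurableD; apply: measurable_modc_lt => //.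
  apply: measurable_complexD => //; apply: measurable_complexM => //.
  apply: measurable_complexM; first exact: measurable_complex_cst.
  apply: (measurable_complex_comp (measurable_inv_sub_ext w1)).
  exact: measurable_snd.
have PS : (P [set t | S (t, Z n t)] <= (4 / N%:R)%:E)%E.
  apply: (conditional_bound iidZ) => // t.
  apply: (small_diameter mu1 moments0 N0); first exact: measurable_xsection.
  move=> u v; rewrite /xsection/= !inE => -[hu hB] [hv _] u1 v1.
  apply: (@affine_small_diameter (rec t n k.+1) (rec t n k) u v k.+1%:R k) => //.
  - by rewrite ler1n.
  - by move/negP: hB; rewrite -leNgt.
  - by move: hu; rewrite /G/= rmorph_nat.
  - by move: hv; rewrite /G/= rmorph_nat.
have mPS : measurable [set t | S (t, Z n t)].
  have := @measurable_pair_fun _ _ _ T (past Z n) (borelC R)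
    (@to_past _ _ _ _ _ _ Z n) (Z n).
  by move=> /(_ measurableT _ mS); rewrite setTI.
apply: (@le_trans _ _ (P ([set t | modc (rec t n k) < delta ^+ k] `|`
    [set t | S (t, Z n t)]))).
  apply: le_measure; rewrite ?inE//; first exact: measurableU.
  move=> t /= ht; have [|h] := boolP (modc (rec t n k) < delta ^+ k); first by left.
  by right; split => //; exact/negP.
apply: (le_trans (measureU2 _ (mE _ _) mPS)).
apply: (le_trans (leeD (IH n kn) PS)).
by rewrite -EFinD lee_fin (mulrSr 1 k) (mulrDl k%:R 1) mul1r.
Qed.

End small_ratio.

(** * Conclusion *)

Section lower_bound.
Context {R : realType}.
Variable mu : probability (borelC R) R.
Hypothesis mu1 : mu circle = 1%E.
Context d (T : measurableType d) (P : probability T R).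
Variable Z : nat -> {RV P >-> borelC R}.
Hypothesis iidZ : iid_with_law P Z mu.
Variable k : nat.

Let ReX m (z : (R[i])^o) : R := Re ((z : R[i]) ^+ m.+1).
Let ImX m (z : (R[i])^o) : R := Im ((z : R[i]) ^+ m.+1).

Definition ratio_not_small (a : nat -> R[i]) :=
  exists v (B : nat), [/\ v != 0, modc v < 1 &
    \forall n \near \oo, n.+1%:R ^- B * modc (sample_poly a n).[v] <=
                         modc (sample_poly a n)^`(k).[v]].

Lemma ae_ratio_not_small_zero_moments :
  (forall m, circle_int mu (ReX m) = 0 /\ circle_int mu (ImX m) = 0) ->
  {ae P, forall t, ratio_not_small (fun i => Z i t)}.
Proof.
move=> moments0; pose v : R[i] := (1 / 2)%:C.
have vm : modc v = 1 / 2 by rewrite modc_real ger0_norm// divr_ge0.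
have v1 : modc v < 1 by rewrite vm; lra.
have v0 : v != 0 by rewrite -modc_gt0 vm divr_gt0.
pose rec t n := ratio_rec (fun i => inv_sub_ext v (Z i t)) n k.
(* This is the threshold for N = (m + 1)^2, for which the probabilities 4 k / (m + 1)^2 are
   summable. The shift to m + k samples in [E] below ensures that there are at least k of them. *)
pose dl m : R := (8 * (m.+1 ^ 2)%:R)^-1.
pose E m := [set t | modc (rec t (m + k)%N) < dl m ^+ k].
have mE m : measurable (E m).
  apply: measurable_modc_lt; apply: (@measurable_rec _ _ _ _ Z v v1 _ _ id) => i _.
  exact: measurable_funPT.
have PE : P (lim_sup_set E) = 0%E.
  apply: lim_sup_set_cvg0 => //.
  apply: le_lt_trans (nneseries_inv_sq_lty (_ : 0 <= 4 * k%:R :> R)); last first.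
    by rewrite mulr_ge0.
  apply: lee_nneseries => // m _.
  apply: le_trans (probability_small_ratio mu1 moments0 iidZ v1 _ (leq_addl m k)) _.
    by rewrite expn_gt0.
  rewrite lee_fin natrX le_eqVlt; apply/orP; left; apply/eqP.
  by ring.
have mlim : measurable (lim_sup_set E).
  by apply: bigcap_measurable => // n _; exact: bigcup_measurable.
have : {ae P, forall t, ~ lim_sup_set E t}.
  by exists (lim_sup_set E); split => // t /= /contrapT.
apply: filterS2 (ae_on_circle mu1 iidZ) => t t1 tE.
(* For m = n - k the threshold is (8 (m + 1)^2)^(-k), and 8 (m + 1)^2 <= (n + 1)^3 (n + 1)^2 once n
   >= 1. *)
exists v, (5 * k)%N; split => //.
have [m0 hm0] : exists m0, forall m, (m0 <= m)%N -> ~ E m t.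
  apply: contrapT => /forallNP h; apply: tE => m _.
  by have /existsNP[j /not_implyP[mj /contrapT Ej]] := h m; exists j.
near=> n; apply: deriv_ratioP => //.
have kn : (m0 + k <= n)%N by near: n; exact: nbhs_infty_ge.
have n1 : (1 <= n)%N by near: n; exact: nbhs_infty_ge.
rewrite deriv_ratioE//.
rewrite (_ : (fun i => (v - Z i t)^-1) = fun i => inv_sub_ext v (Z i t)); last first.
  by apply/funext => i; rewrite inv_sub_extE.
have m0n : (m0 <= n - k)%N by rewrite leq_subRL ?(leq_trans _ kn) ?leq_addl// addnC.
have kn' : (k <= n)%N by rewrite (leq_trans _ kn)// leq_addl.
have /negP := hm0 _ m0n; rewrite /rec subnK// -leNgt.
apply: le_trans; rewrite exprM /dl -exprVn lerXn2r ?nnegrE ?invr_ge0//.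
rewrite lef_pV2 ?posrE ?mulr_gt0 ?exprn_gt0 ?ltr0n ?expn_gt0//.
rewrite -!natrX -natrM ler_nat.
have h8 : (8 <= n.+1 ^ 3)%N by rewrite -[8%N]/(2 ^ 3)%N leq_exp2r.
by rewrite -[5%N]/(3 + 2)%N expnD leq_mul// leq_exp2r// ltnS leq_subr.
Unshelve. all: by end_near. Qed.

Lemma modc_sum_div (a : nat -> R[i]) m n :
  modc (\sum_(i < n) a i ^+ m.+1) / n%:R =
  Num.sqrt (avg (mkseq a n) (ReX m) ^+ 2 + avg (mkseq a n) (ImX m) ^+ 2).
Proof.
rewrite !avg_mkseq /ReX /ImX -Re_sum -Im_sum !expr_div_n -mulrDl -modc_sq.
by rewrite -expr_div_n sqrtr_sqr ger0_norm// divr_ge0// modc_ge0.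
Qed.

Lemma ae_ratio_not_small_nonzero_moment m :
  ~ (circle_int mu (ReX m) = 0 /\ circle_int mu (ImX m) = 0) ->
  {ae P, forall t, ratio_not_small (fun i => Z i t)}.
Proof.
move=> hm; pose nz j := ~~ ((circle_int mu (ReX j) == 0) && (circle_int mu (ImX j) == 0)).
have exnz : exists j, nz j.
  by exists m; apply/negP => /andP[/eqP ? /eqP ?]; exact: hm.
case: (ex_minnP exnz) => {hm}m nzm minm.
have aeR : {ae P, forall t, forall j,
    (fun n => avg (mkseq (fun i => Z i t) n) (ReX j)) @ \oo --> circle_int mu (ReX j)}.
  apply: ae_foralln => j; apply: slln_circle => //.
  exact: (ReXn_ImXn_continuous _).1.
have aeI : {ae P, forall t, forall j,
    (fun n => avg (mkseq (fun i => Z i t) n) (ImX j)) @ \oo --> circle_int mu (ImX j)}.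
  apply: ae_foralln => j; apply: slln_circle => //.
  exact: (ReXn_ImXn_continuous _).2.
have := ae_on_circle mu1 iidZ; apply: filterS3 aeR aeI => t tR tI t1.
pose a i : R[i] := Z i t.
have cvgm j : (fun n => modc (\sum_(i < n) a i ^+ j.+1) / n%:R) @ \oo -->
    Num.sqrt (circle_int mu (ReX j) ^+ 2 + circle_int mu (ImX j) ^+ 2).
  under eq_fun do rewrite modc_sum_div.
  apply: continuous_cvg; first exact: sqrt_continuous.
  apply: cvgD.
    exact: (cvg_comp _ _ (tR j) (@exprn_continuous R 2 _)).
  exact: (cvg_comp _ _ (tI j) (@exprn_continuous R 2 _)).
have [|j jm|v [v0 v1 [eta eta0 hv]]] := moments_lower_bound (m := m) t1 _ _ (cvgm m).
- rewrite sqrtr_gt0 lt_def addr_ge0 ?sqr_ge0// andbT.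
  by rewrite paddr_eq0 ?sqr_ge0// !sqrf_eq0.
- have := cvgm j; have : ~~ nz j by apply/negP => /minm; rewrite leqNgt jm.
  by rewrite negbK => /andP[/eqP -> /eqP ->]; rewrite !expr0n/= addr0 sqrtr0.
(* The ratio is eventually at least 1, so no power of n is lost. *)
exists v, 0%N; split => //.
have := deriv_ratio_ge1 t1 v1 k eta0 hv; apply: filterS => n hn.
by rewrite expr0 invr1; exact: deriv_ratioP.
Qed.

Lemma ae_ratio_not_small : {ae P, forall t, ratio_not_small (fun i => Z i t)}.
Proof.
have [h|/existsNP[m hm]] := pselect (forall m,
    circle_int mu (ReX m) = 0 /\ circle_int mu (ImX m) = 0).
  exact: ae_ratio_not_small_zero_moments.
exact: ae_ratio_not_small_nonzero_moment hm.
Qed.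

End lower_bound.

Theorem theorem2 (R : realType) (mu : probability (borelC R) R)
    (hmu : mu [set z : R[i] | `|z| = 1] = 1%E)
    (d : measure_display) (T : measurableType d) (P : probability T R)
    (Z : nat -> {RV P >-> borelC R}) (hZ : iid_with_law P Z mu)
    (k : nat) (hk : (1 <= k)%N) :
  {ae P, forall w : T,
    weakly_converges (derivn_zeros_measure (fun i => Z i w) k) mu}.
Proof.
have mu1 : mu circle = 1%E by [].
have aeP : {ae P, forall w, forall l M i : nat, (i <= M)%N ->
    (fun n => avg (mkseq (fun i => Z i w) n) (poisson_ext (nodes l M)`_i))
      @ \oo --> circle_int mu (poisson_ext (nodes l M)`_i)}.
  apply: ae_foralln => l; apply: ae_foralln => M; apply: ae_foralln => i.
  (* Beyond index [M] the default value 0 would be read from the list of nodes, and 0 is not a pole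
     outside the disk. *)
  have [iM|iM] := leqP i M; last exact: aeW.
  have : {ae P, forall w, (fun n => avg (mkseq (fun i => Z i w) n)
      (poisson_ext (nodes l M)`_i)) @ \oo --> circle_int mu (poisson_ext (nodes l M)`_i)}.
    apply: slln_circle => //; apply: poisson_ext_continuous.
    rewrite (modc_node (mem_nth 0 _)) ?radius_gt1// size_nodes//.
  by apply: filterS => w h _.
have := ae_on_circle mu1 hZ; apply: filterS3 aeP (ae_ratio_not_small mu1 hZ k).
move=> w hP [v [B [v0 v1 hB]]] w1 f cf [M fM].
rewrite (integral_circle mu1 cf fM).
have hW := avg_derivn_zeros_cvg w1 cf v0 v1 hB.
have hZf := empirical_cvg mu1 w1 cf hP.
have h : (fun n => avg (zeros (sample_poly (fun i => Z i w) n)^`(k)) f) @ \oo -->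
    circle_int mu f.
  rewrite -[X in _ --> X]add0r (_ : (fun n => _) = (fun n =>
      avg (zeros (sample_poly (fun i => Z i w) n)^`(k)) f -
      avg (mkseq (fun i => Z i w) n) f + avg (mkseq (fun i => Z i w) n) f)).
    exact: cvgD hW hZf.
  by apply/funext => n; rewrite subrK.
apply: (@cvg_trans _ (EFin \o (fun n =>
    avg (zeros (sample_poly (fun i => Z i w) n)^`(k)) f) @ \oo)).
  (* The integral is an average over the zeros only once n > k, hence the eventual equality. *)
  apply: near_eq_cvg; near=> n; rewrite /= integral_derivn_zeros//.
  by near: n; exact: nbhs_infty_gt.
by apply: cvg_EFin => //; exact: nearW.
Unshelve. all: by end_near. Qed.
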